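(* Fix $Q\in\mathcal H(B)$ with $\|Q\|_B<\rho$. There is a dense subset $\Lambda'\subset\Lambda$ such that for every $\lambda\in\Lambda'$ the map $Q^*_\lambda=P_\lambda+Q$ has a wandering disc contained in its filled Julia set $K(Q^*_\lambda,B)$, and this disc is not attracted to an attracting cycle.
   Context: Let $p$ be a prime and $\mathbb C_p$ the completion of an algebraic closure of $\mathbb Q_p$, with $p$-adic absolute value $|\cdot|$ normalized by $|p|=1/p$. Let $\Lambda=\{\lambda\in\mathbb C_p:|\lambda-1|<1\}$ and, for $\lambda\in\Lambda$, $P_\lambda(z)=\frac{\lambda}{p}z^p+\left(1-\frac{\lambda}{p}\right)z^{p+1}$. Let $\rho=p^{-1/(p-1)}$. Fix $\hat r\in|\mathbb C_p^*|=\{p^r:r\in\mathbb Q\}$ with $\hat r>1$ and set $B=\{z\in\mathbb C_p:|z|\le\hat r\}$. $\mathcal H(B)$ denotes the ring of power series $f(z)=\sum_{i\ge0}a_iz^i$ with $a_i\in\mathbb C_p$ converging on $B$, with norm $\|f\|_B=\sup_{i\ge0}|a_i|\hat r^{\,i}$. For a map $f$ defined on $B$, its filled Julia set is $K(f,B)=\{z\in B: f^n(z)\in B\text{ for all }n\ge0\}$. A set $D$ (here a closed ball) is a wandering disc for $f$ if $f^n(D)\cap f^m(D)\neq\emptyset$ only when $n=m$. A periodic point $z_0$ of period $k$ is attracting if $|(f^k)'(z_0)|<1$; the disc $D$ is ''not attracted to an attracting cycle'' if no point of $D$ lies in an open ball contained in the basin of attraction of an attracting periodic orbit. *)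

(* Defs.v *)
From HB Require Import structures.
From mathcomp Require Import all_boot all_order all_algebra.
From mathcomp Require Import all_classical all_reals all_analysis.
Set Implicit Arguments. Unset Strict Implicit. Unset Printing Implicit Defensive.
Import Order.TTheory GRing.Theory Num.Theory.
Local Open Scope ring_scope.

Section Defs.
Variables (R : realType) (K : fieldType) (abs : K -> R).

Definition kcvg (u : nat -> K) (l : K) : Prop :=
  forall eps : R, 0 < eps -> exists N : nat, forall n : nat, (N <= n)%N ->
    abs (u n - l) < eps.

Definition kcauchy (u : nat -> K) : Prop :=
  forall eps : R, 0 < eps -> exists N : nat, forall m n : nat,
    (N <= m)%N -> (N <= n)%N -> abs (u m - u n) < eps.

(* (K, abs) is (an isometric copy of) C_p: an algebraically closed field
   (K : closedFieldType) with a non-archimedean absolute value, |p| = 1/p,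
   complete, in which the elements algebraic over Q are dense. *)
Definition is_Cp (p : nat) : Prop :=
  (forall x, 0 <= abs x) /\
  (forall x, abs x = 0 <-> x = 0) /\
  (forall x y, abs (x * y) = abs x * abs y) /\
  (forall x y, abs (x + y) <= Num.max (abs x) (abs y)) /\
  abs (p%:R) = (p%:R)^-1 /\
  (forall u, kcauchy u -> exists l, kcvg u l) /\
      (forall x (eps : R), 0 < eps -> exists y : K, abs (x - y) < eps /\
        exists q : {poly rat}, q != 0 /\ root (map_poly (fun r : rat => ratr r) q) y).

Definition has_deriv (g : K -> K) (z d : K) : Prop :=
  forall eps : R, 0 < eps -> exists delta : R, 0 < delta /\
    forall w, 0 < abs (w - z) < delta ->
      abs ((g w - g z) / (w - z) - d) < eps.

Definition inB (rhat : R) (z : K) : Prop := abs z <= rhat.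

Definition filled_julia (f : K -> K) (rhat : R) (z : K) : Prop :=
  forall n : nat, inB rhat (iter n f z).

Definition attracting_periodic (f : K -> K) (rhat : R) (z0 : K) (k : nat) : Prop :=
  [/\ (0 < k)%N, filled_julia f rhat z0, iter k f z0 = z0 &
      exists d, has_deriv (iter k f) z0 d /\ abs d < 1].

Definition in_basin (f : K -> K) (rhat : R) (z0 : K) (k : nat) (z : K) : Prop :=
  filled_julia f rhat z /\
  forall eps : R, 0 < eps -> exists N : nat, forall n : nat, (N <= n)%N ->
    exists j : nat, (j < k)%N /\ abs (iter n f z - iter j f z0) < eps.

Definition kclosed_ball (c : K) (s : R) (z : K) : Prop := abs (z - c) <= s.
Definition kopen_ball (c : K) (s : R) (z : K) : Prop := abs (z - c) < s.

Definition wandering (f : K -> K) (D : K -> Prop) : Prop :=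
  forall n m : nat,
    (exists w, (exists x, D x /\ iter n f x = w) /\ (exists y, D y /\ iter m f y = w)) ->
    n = m.

Definition not_attracted (f : K -> K) (rhat : R) (D : K -> Prop) : Prop :=
  ~ exists z, D z /\ exists z0 k, attracting_periodic f rhat z0 k /\
      exists c (s : R), 0 < s /\ kopen_ball c s z /\
        forall w, kopen_ball c s w -> in_basin f rhat z0 k w.

End Defs.

Definition Qstar (K : fieldType) (p : nat) (lam : K) (Qf : K -> K) (z : K) : K :=
  lam / p%:R * z ^+ p + (1 - lam / p%:R) * z ^+ p.+1 + Qf z.

(* Main.v *)
(* Let E be the open unit disc about 1 and choose y_0 = 1, y_{k+1}^p = p y_k,
   U_k = D(y_k, |y_k|^-), so that U_0 = E and rho < |y_k| <= 1.  For every
   lambda in Lambda, the map f sends U_{k+1} into U_k and contracts relative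
   distances by a fixed factor th < 1, while on E it multiplies distances by p.
   An orbit that starts near 1, jumps into U_k, returns to E after k steps and
   then stays in E for M more steps, with p^M th^k small, therefore carries a
   small disc along with it.  If this happens infinitely often with M going to
   infinity, the itinerary of the disc has arbitrarily long but finite runs
   in E, hence is not eventually periodic: the disc wanders and is not attracted
   to a cycle.

   Such a lambda is the intersection of nested parameter discs.  The n-th iterate
   of the base point, as a function F_n of lambda, is uniformly close to a
   polynomial.  Keep a disc V that F_n maps into U_k, together with a point v on
   its boundary at which |F_n| < |y_k|.  A polynomial g with |g(x)| < |g(z)| has
   a root closer to x than z is, so when k = 0 the image of V is almost all of E, and
   F_{n+1}(V), which is p times larger, reaches any U_k' as well as 0; a smaller
   disc bounded by a nearest zero is a new disc of the same kind.  In the steps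
   from U_{k+1} to U_k the pair (V, v) is kept unchanged.  The radii tend to 0
   because, after a long stay in the U_k, the images of two parameters are
   exactly as far apart as the parameters, a distance that is then multiplied by
   p at each step in E. *)
Require Import Defs.
From HB Require Import structures.
From mathcomp Require Import all_boot all_order all_algebra.
From mathcomp Require Import all_classical all_reals all_analysis.
From mathcomp Require Import ring.
Import Order.TTheory GRing.Theory Num.Theory.
Local Open Scope ring_scope.

Section Ultrametric.
Set Implicit Arguments.
Unset Strict Implicit.
Variables (R : realType) (K : closedFieldType) (abs : K -> R).
Hypothesis abs_ge0 : forall x, 0 <= abs x.
Hypothesis abs_eq0 : forall x, abs x = 0 <-> x = 0.
Hypothesis absM : forall x y, abs (x * y) = abs x * abs y.
Hypothesis absD_max : forall x y, abs (x + y) <= Num.max (abs x) (abs y).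

(** * Ultrametric absolute values *)

Lemma abs0 : abs 0 = 0.
Proof. exact/abs_eq0. Qed.

Lemma abs_neq0 x : x != 0 -> abs x != 0.
Proof. by apply: contraNneq => /abs_eq0 ->. Qed.

Lemma abs_gt0 x : (0 < abs x) = (x != 0).
Proof.
rewrite lt_neqAle abs_ge0 andbT eq_sym.
by apply/idP/idP; [apply: contraNneq => ->; rewrite abs0 | exact: abs_neq0].
Qed.

Lemma abs1 : abs 1 = 1.
Proof.
apply: (mulfI (abs_neq0 (oner_neq0 K))).
by rewrite -absM !mulr1.
Qed.

Lemma absX x n : abs (x ^+ n) = abs x ^+ n.
Proof. by elim: n => [|n IH]; rewrite ?expr0 ?abs1// !exprS absM IH. Qed.

Lemma absN x : abs (- x) = abs x.
Proof.
apply: (@pexpIrn R 2); rewrite ?nnegrE ?abs_ge0//.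
by rewrite -!absX sqrrN.
Qed.

Lemma absV x : abs x^-1 = (abs x)^-1.
Proof.
have [->|x0] := eqVneq x 0; first by rewrite invr0 abs0 invr0.
by apply: (mulfI (abs_neq0 x0)); rewrite -absM !divff ?abs1 ?abs_neq0.
Qed.

Lemma abs_subC x y : abs (x - y) = abs (y - x).
Proof. by rewrite -opprB absN. Qed.

Lemma absD_le b x y : abs x <= b -> abs y <= b -> abs (x + y) <= b.
Proof. by move=> hx hy; apply: le_trans (absD_max _ _) _; rewrite ge_max hx. Qed.

Lemma absD_lt b x y : abs x < b -> abs y < b -> abs (x + y) < b.
Proof. by move=> hx hy; apply: le_lt_trans (absD_max _ _) _; rewrite gt_max hx. Qed.

Lemma absB_le b x y : abs x <= b -> abs y <= b -> abs (x - y) <= b.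
Proof. by move=> hx hy; apply: absD_le; rewrite ?absN. Qed.

Lemma absB_lt b x y : abs x < b -> abs y < b -> abs (x - y) < b.
Proof. by move=> hx hy; apply: absD_lt; rewrite ?absN. Qed.

Lemma abs_dist_le b x y z :
  abs (x - y) <= b -> abs (y - z) <= b -> abs (x - z) <= b.
Proof. by move=> h1 h2; rewrite -(subrKA y); apply: absD_le. Qed.

Lemma abs_dist_lt b x y z :
  abs (x - y) < b -> abs (y - z) < b -> abs (x - z) < b.
Proof. by move=> h1 h2; rewrite -(subrKA y); apply: absD_lt. Qed.

Lemma absD_dom x y : abs y < abs x -> abs (x + y) = abs x.
Proof.
move=> yx; apply/eqP; rewrite eq_le (absD_le (lexx _) (ltW yx)) /= leNgt.
apply/negP => h; have := absB_lt h yx.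
by rewrite addrK ltxx.
Qed.

Lemma abs_near x y : abs (x - y) < abs y -> abs x = abs y.
Proof. by move=> h; rewrite -[x](subrK y) addrC absD_dom. Qed.

Lemma abs_nat n : abs n%:R <= 1.
Proof.
elim: n => [|n IH]; first by rewrite abs0 ler01.
by rewrite -natr1; apply: absD_le; rewrite ?abs1.
Qed.

Lemma abs_sum (I : Type) (r : seq I) (P : pred I) (F : I -> K) b :
  0 <= b -> (forall i, P i -> abs (F i) <= b) -> abs (\sum_(i <- r | P i) F i) <= b.
Proof.
move=> b0 h; elim/big_rec: _ => [|i x Pi hx]; first by rewrite abs0.
by apply: absD_le => //; apply: h.
Qed.

Lemma abs_prod (r : seq K) (F : K -> K) :
  abs (\prod_(i <- r) F i) = \prod_(i <- r) abs (F i).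
Proof. by elim: r => [|i r IH]; rewrite ?big_nil ?abs1// !big_cons absM IH. Qed.

(** * Roots of polynomials in ultrametric discs *)

Lemma poly_split (g : {poly K}) :
  exists2 rs : seq K, (forall r, r \in rs -> g != 0 -> root g r) &
    forall x, g.[x] = lead_coef g * \prod_(r <- rs) (x - r).
Proof.
have [rs hg] := closed_field_poly_normal g; exists rs => [r rin g0|x].
  by rewrite hg rootZ ?lead_coef_eq0// root_prod_XsubC.
rewrite {1}hg hornerZ horner_prod; congr (_ * _).
by apply: eq_bigr => r _; rewrite hornerXsubC.
Qed.

(** Factor g. If every root r had |r - x| >= |x - z|, then |z - r| <= |x - r| for each linear
    factor, so |g(z)| <= |g(x)|. *)
Lemma poly_root_near (g : {poly K}) x z :
  abs g.[x] < abs g.[z] -> exists2 a, g.[a] = 0 & abs (a - x) < abs (x - z).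
Proof.
move=> lt_gxz; have g0 : g != 0.
  by apply: contraTneq lt_gxz => ->; rewrite !horner0 ltxx.
have [rs rsP hg] := poly_split g.
have [/hasP[r rin hr]|/hasPn far] := boolP (has (fun r => abs (r - x) < abs (x - z)) rs).
  by exists r => //; apply/eqP/(rsP _ rin).
suff : abs g.[z] <= abs g.[x] by rewrite leNgt lt_gxz.
rewrite !hg !absM ler_wpM2l// !abs_prod big_seq [leRHS]big_seq.
apply: ler_prod => r /far; rewrite abs_ge0 -leNgt /= => hr.
apply: (@abs_dist_le _ z x r); last exact: lexx.
by rewrite abs_subC (abs_subC x r).
Qed.

Lemma prod_near (rs : seq K) x s :
  (forall r, r \in rs -> abs (s - x) < abs (x - r)) ->
  abs (\prod_(r <- rs) (s - r) - \prod_(r <- rs) (x - r)) < abs (\prod_(r <- rs) (x - r)).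
Proof.
elim: rs => [|r rs IH] h; first by rewrite !big_nil subrr abs0 abs1 ltr01.
rewrite !big_cons; set A := \prod_(r <- rs) (s - r); set B := \prod_(r <- rs) (x - r).
have hAB : abs (A - B) < abs B by apply: IH => r' hr'; apply: h; rewrite inE hr' orbT.
have hr := h r (mem_head _ _).
have -> : (s - r) * A - (x - r) * B = (s - x) * A + (x - r) * (A - B) by ring.
rewrite absM; apply: absD_lt; rewrite absM.
  by rewrite (abs_near hAB) ltr_pM2r// (le_lt_trans (abs_ge0 _) hAB).
by rewrite ltr_pM2l// (le_lt_trans (abs_ge0 _) hr).
Qed.

Lemma nearest_exists (rs : seq K) x r0 : r0 \in rs ->
  exists2 r, r \in rs & forall r', r' \in rs -> abs (x - r) <= abs (x - r').
Proof.
elim: rs r0 => // q rs IH r0 _; case: rs IH => [|q' rs] IH.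
  by exists q => [|r']; rewrite inE// => /eqP ->.
have [r rin hr] := IH q' (mem_head _ _).
have [le_qr|lt_rq] := leP (abs (x - q)) (abs (x - r)).
  exists q => [|r']; first exact: mem_head.
  by rewrite inE => /predU1P[->//|/hr]; apply: le_trans.
exists r => [|r']; first by rewrite inE rin orbT.
by rewrite inE => /predU1P[->|/hr//]; apply: ltW.
Qed.

(** Some root lies within |m - z| of m, for otherwise [prod_near] would force |g(z) - g(m)| <
    |g(m)|. Let v be a root nearest to m: the open ball of radius |m - v| about m has no root, and
    [prod_near] applies on all of it. *)
Lemma poly_nearest_root (g : {poly K}) m z :
  g.[m] != 0 -> abs g.[m] <= abs (g.[z] - g.[m]) ->
  exists v, [/\ g.[v] = 0, abs (m - v) <= abs (m - z) &
    forall s, abs (s - m) < abs (m - v) -> abs (g.[s] - g.[m]) < abs g.[m]].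
Proof.
move=> gm0 hz; have g0 : g != 0 by apply: contraNneq gm0 => ->; rewrite horner0.
have [rs rsP hg] := poly_split g.
have near s : (forall r, r \in rs -> abs (s - m) < abs (m - r)) ->
    abs (g.[s] - g.[m]) < abs g.[m].
  move=> h; rewrite !hg -mulrBr !absM ltr_pM2l ?prod_near//.
  by rewrite abs_gt0 lead_coef_eq0.
have [/hasP[r0 r0in hr0]|/hasPn far] :=
    boolP (has (fun r => abs (m - r) <= abs (m - z)) rs); last first.
  suff : abs (g.[z] - g.[m]) < abs g.[m] by rewrite ltNge hz.
  by apply: near => r /far; rewrite -ltNge abs_subC.
have [v vin hv] := nearest_exists m r0in.
exists v; split; first by apply/eqP/(rsP _ vin).
  exact: le_trans (hv _ r0in) hr0.
by move=> s hs; apply: near => r /hv; apply: lt_le_trans.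
Qed.

Lemma kcvg_abs_le (u : nat -> K) l b N : 0 <= b -> kcvg abs u l ->
  (forall n, (N <= n)%N -> abs (u n) <= b) -> abs l <= b.
Proof.
move=> b0 ul ub; rewrite leNgt; apply/negP => bl.
have [M hM] := ul _ (le_lt_trans b0 bl).
have := ub _ (leq_maxl N M).
by rewrite (abs_near (hM _ (leq_maxr N M))) leNgt bl.
Qed.

Lemma kcvgB (u w : nat -> K) l m :
  kcvg abs u l -> kcvg abs w m -> kcvg abs (fun n => u n - w n) (l - m).
Proof.
move=> ul wm e e0; have [N hN] := ul e e0; have [M hM] := wm e e0.
exists (maxn N M) => n; rewrite geq_max => /andP[hn hn'].
have -> : u n - w n - (l - m) = (u n - l) - (w n - m) by ring.
by apply: absB_lt; [exact: hN | exact: hM].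
Qed.

(** * Power series on the unit disc *)

Section PowerSeries.
Variables (a : nat -> K) (F : K -> K) (r c : R).
Hypothesis r_gt1 : 1 < r.
Hypothesis a_le : forall i, abs (a i) * r ^+ i <= c.
Hypothesis F_sum : forall z, abs z <= 1 ->
  kcvg abs (fun n => \sum_(i < n) a i * z ^+ i) (F z).

Lemma series_bound_ge0 : 0 <= c.
Proof. by apply: le_trans (a_le 0); rewrite mulr1. Qed.

Lemma coef_le i : abs (a i) <= c.
Proof. by apply: le_trans (a_le i); rewrite ler_peMr// exprn_ege1// ltW. Qed.

Lemma series_abs_le z : abs z <= 1 -> abs (F z) <= c.
Proof.
move=> hz; apply: (kcvg_abs_le (N := 0%N) series_bound_ge0 (F_sum hz)) => n _.
apply: abs_sum => [|i _]; first exact: series_bound_ge0.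
rewrite absM absX; apply: le_trans (coef_le i).
by rewrite ler_piMr// exprn_ile1.
Qed.

Lemma series_lip z w : abs z <= 1 -> abs w <= 1 ->
  abs (F z - F w) <= c * abs (z - w).
Proof.
move=> hz hw; have c0 := series_bound_ge0.
apply: (kcvg_abs_le (N := 0%N) _ (kcvgB (F_sum hz) (F_sum hw))) => [|n _].
  by rewrite mulr_ge0.
rewrite -sumrB; apply: abs_sum => [|i _]; first by rewrite mulr_ge0.
rewrite -mulrBr absM; apply: ler_pM => //; first exact: coef_le.
rewrite subrXX absM ler_piMr//; apply: abs_sum => // j _.
by rewrite absM !absX mulr_ile1 ?exprn_ge0 ?exprn_ile1.
Qed.

(** As r > 1, the coefficients from index t on are at most c / r^t, so the truncations converge
    uniformly on the unit disc. *)
Lemma series_tail_le z t : abs z <= 1 ->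
  abs (F z - (\poly_(i < t) a i).[z]) <= c * r^-1 ^+ t.
Proof.
move=> hz; have c0 := series_bound_ge0; have r0 := lt_trans ltr01 r_gt1.
have b0 : 0 <= c * r^-1 ^+ t by rewrite mulr_ge0// exprn_ge0// invr_ge0 ltW.
have hcst : kcvg abs (fun=> (\poly_(i < t) a i).[z]) (\poly_(i < t) a i).[z].
  by move=> e e0; exists 0%N => n _; rewrite subrr abs0.
apply: (kcvg_abs_le (N := t) b0 (kcvgB (F_sum hz) hcst)) => n tn.
rewrite horner_poly -!(big_mkord xpredT (fun i => a i * z ^+ i)).
have -> : \sum_(0 <= i < n) a i * z ^+ i =
    \sum_(0 <= i < t) a i * z ^+ i + \sum_(t <= i < n) a i * z ^+ i.
  exact: big_cat_nat.
rewrite addrC addKr.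
rewrite big_nat; apply: abs_sum => // i /andP[ti _]; rewrite absM absX.
apply: le_trans (_ : abs (a i) * 1 <= _); first by rewrite ler_wpM2l// exprn_ile1.
rewrite mulr1 exprVn ler_pdivlMr ?exprn_gt0//; apply: le_trans (a_le i).
by rewrite ler_wpM2l// ler_weXn2l// ltW.
Qed.

End PowerSeries.

(** * Expansion near 1 and contraction near y_k *)

Variables (p : nat) (hp : prime p).
Hypothesis absp : abs p%:R = p%:R^-1.
Let P : R := p%:R.

Lemma P_gt1 : 1 < P.
Proof. by rewrite ltr1n prime_gt1. Qed.

Lemma P_gt0 : 0 < P.
Proof. exact: lt_trans ltr01 P_gt1. Qed.

Lemma p_neq0 : p%:R != 0 :> K.
Proof. by rewrite -abs_gt0 absp invr_gt0 P_gt0. Qed.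

(** In the binomial expansion the middle terms gain 1/P from the binomial coefficient, and the last
    one, h^p, gains t^p <= t * t. Division by p later turns this into a contraction of relative
    distances. *)
Lemma absXD_sub z h t : 0 <= t <= 1 -> abs h <= t * abs z ->
  abs ((z + h) ^+ p - z ^+ p) <= Num.max t P^-1 * t * abs z ^+ p.
Proof.
move=> /andP[t0 t1] ht; have p0 := prime_gt0 hp; have p1 := prime_gt1 hp.
have z0 := abs_ge0 z; have h0 := abs_ge0 h; have P0 := P_gt0.
have tz0 : 0 <= t * abs z by rewrite mulr_ge0.
rewrite exprDn big_ord_recl bin0 subn0 expr0 mulr1 mulr1n addrC addKr.
apply: abs_sum => [|i _].
  by rewrite !mulr_ge0 ?exprn_ge0// le_max t0.
rewrite -mulr_natr !absM !absX lift0.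
have hpi : abs z ^+ (p - i.+1) * abs h ^+ i.+1 <= t ^+ i.+1 * abs z ^+ p.
  have -> : abs z ^+ p = abs z ^+ (p - i.+1) * abs z ^+ i.+1 by rewrite -exprD subnK.
  by rewrite mulrCA ler_wpM2l ?exprn_ge0// -exprMn lerXn2r ?nnegrE.
have [ip|ip] := eqVneq i.+1 p.
  have -> : 'C(p, i.+1) = 1%N by rewrite ip binn.
  rewrite mulr1n abs1 mulr1; apply: le_trans hpi _.
  rewrite ler_wpM2r ?exprn_ge0//; apply: le_trans (_ : t * t <= _).
    by rewrite -expr2 ler_wiXn2l ?t0// ip.
  by rewrite ler_wpM2r// le_max lexx.
have lt_ip : (i.+1 < p)%N by rewrite ltn_neqAle ip ltn_ord.
have /dvdnP[q ->] : (p %| 'C(p, i.+1))%N by apply: prime_dvd_bin.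
rewrite natrM absM absp -/P; apply: le_trans (_ : t ^+ i.+1 * abs z ^+ p * (1 * P^-1) <= _).
  apply: ler_pM => //; rewrite ?mulr_ge0 ?exprn_ge0 ?invr_ge0 ?(ltW P0)//.
  by rewrite ler_wpM2r ?invr_ge0 ?(ltW P0)// abs_nat.
rewrite mul1r mulrAC ler_wpM2r ?exprn_ge0// mulrC.
apply: ler_pM; rewrite ?invr_ge0 ?(ltW P0) ?exprn_ge0//.
  by rewrite le_max lexx orbT.
by rewrite exprS ler_piMr// exprn_ile1.
Qed.

Lemma absX_sub z z' n : abs z <= 1 -> abs z' <= 1 ->
  abs (z ^+ n - z' ^+ n) <= abs (z - z').
Proof.
move=> hz hz'; rewrite subrXX absM ler_piMr//.
apply: abs_sum => // i _; rewrite absM !absX.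
by rewrite mulr_ile1 ?exprn_ge0 ?exprn_ile1.
Qed.

Variables (Q : K -> K) (c rho : R).
Hypothesis c_ge0 : 0 <= c.
Hypothesis c_lt_rho : c < rho.
Hypothesis rhoE : P * rho ^+ p.-1 = 1.
Hypothesis Q_le : forall z, abs z <= 1 -> abs (Q z) <= c.
Hypothesis Q_lip : forall z w, abs z <= 1 -> abs w <= 1 ->
  abs (Q z - Q w) <= c * abs (z - w).

Local Notation f := (fun l : K => Qstar p l Q).
Local Notation inD l := (abs (l - 1) < 1).

Lemma rho_gt0 : 0 < rho.
Proof. exact: le_lt_trans c_lt_rho. Qed.

Lemma rho_lt1 : rho < 1.
Proof.
rewrite ltNge; apply/negP => h; have : P <= 1.
  by rewrite -[leRHS]rhoE ler_peMr ?exprn_ege1// ltW// P_gt0.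
by rewrite leNgt P_gt1.
Qed.

Lemma c_lt1 : c < 1.
Proof. exact: lt_trans rho_lt1. Qed.

Lemma rhoXp : P * rho ^+ p = rho.
Proof. by rewrite -[in LHS](prednK (prime_gt0 hp)) exprSr mulrA rhoE mul1r. Qed.

Lemma abs_near1 l : inD l -> abs l = 1.
Proof. by rewrite -abs1 => /abs_near. Qed.

(** This form puts the large coefficient 1/p on a single summand, which vanishes at 1; the others
    are at most 1 on the unit disc. *)
Lemma QstarE l z :
  Qstar p l Q z = l / p%:R * (z ^+ p * (1 - z)) + z ^+ p.+1 + Q z.
Proof. by rewrite /Qstar exprSr; ring. Qed.

Lemma abs_divp x : abs (x / p%:R) = P * abs x.
Proof. by rewrite absM absV absp invrK mulrC. Qed.

(** Separates the effect of the parameter, which is exactly linear, from that of the point. *)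
Lemma Qstar_sub l l' z z' : Qstar p l Q z - Qstar p l' Q z' =
  (l - l') / p%:R * (z ^+ p * (1 - z)) + (Qstar p l' Q z - Qstar p l' Q z').
Proof. by rewrite !QstarE; ring. Qed.

Lemma Qstar_lip l z z' : abs l <= 1 -> abs z <= 1 -> abs z' <= 1 ->
  abs (Qstar p l Q z - Qstar p l Q z') <= P * abs (z - z').
Proof.
move=> hl hz hz'; have P1 := ltW P_gt1; have d0 := abs_ge0 (z - z').
have le1 : abs (z - z') <= P * abs (z - z') by rewrite ler_peMl.
have -> : Qstar p l Q z - Qstar p l Q z' = l / p%:R * (z ^+ p - z' ^+ p) -
    l / p%:R * (z ^+ p.+1 - z' ^+ p.+1) + (z ^+ p.+1 - z' ^+ p.+1) + (Q z - Q z').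
  by rewrite /Qstar; ring.
have hX n : abs (l / p%:R * (z ^+ n - z' ^+ n)) <= P * abs (z - z').
  rewrite absM abs_divp; apply: ler_pM; rewrite ?mulr_ge0 ?(ltW P_gt0) ?absX_sub//.
  by rewrite ler_piMr// ltW// P_gt0.
apply: absD_le; last first.
  apply: le_trans (Q_lip hz hz') _; apply: le_trans le1.
  by rewrite ler_piMl// ltW// c_lt1.
by apply: absD_le; [exact: absB_le | apply: le_trans le1; exact: absX_sub].
Qed.

Lemma Qstar_lip2 l l' z z' b : abs l' <= 1 -> abs z <= 1 -> abs z' <= 1 ->
  abs (l - l') <= b -> abs (z - z') <= b ->
  abs (Qstar p l Q z - Qstar p l' Q z') <= P * b.
Proof.
move=> hl hz hz' hll hzz; rewrite Qstar_sub; apply: absD_le.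
  rewrite absM abs_divp absM -mulrA ler_wpM2l ?(ltW P_gt0)//.
  rewrite -[leRHS]mulr1; apply: ler_pM; rewrite ?mulr_ge0// absX.
  by rewrite mulr_ile1 ?exprn_ge0 ?exprn_ile1// absB_le ?abs1.
by apply: le_trans (Qstar_lip hl hz hz') _; rewrite ler_wpM2l// ltW// P_gt0.
Qed.

(** On E the map z^p (1 - z) is an isometry, its dominant variation being z'^p (z' - z). The factor
    l/p scales it by P, and the remaining terms are 1-Lipschitz. *)
Lemma Qstar_expand l z z' : abs l = 1 -> abs (z - 1) < 1 -> abs (z' - 1) < 1 ->
  abs (Qstar p l Q z - Qstar p l Q z') = P * abs (z - z').
Proof.
move=> hl hz hz'; have [->|nzz] := eqVneq z z'; first by rewrite !subrr !abs0 mulr0.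
have d0 : 0 < abs (z - z') by rewrite abs_gt0 subr_eq0.
have az := abs_near1 hz; have az' := abs_near1 hz'.
have leX n : abs (z ^+ n - z' ^+ n) <= abs (z - z') by rewrite absX_sub ?az ?az'.
have main : abs (z ^+ p * (1 - z) - z' ^+ p * (1 - z')) = abs (z - z').
  have -> : z ^+ p * (1 - z) - z' ^+ p * (1 - z') =
      z' ^+ p * (z' - z) + (z ^+ p - z' ^+ p) * (1 - z) by ring.
  have e : abs (z' ^+ p * (z' - z)) = abs (z - z').
    by rewrite absM absX az' expr1n mul1r abs_subC.
  rewrite absD_dom// e absM; apply: le_lt_trans (_ : abs (z - z') * abs (1 - z) < _).
    by rewrite ler_wpM2r.
  by rewrite gtr_pMr// abs_subC.
have -> : Qstar p l Q z - Qstar p l Q z' =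
    l / p%:R * (z ^+ p * (1 - z) - z' ^+ p * (1 - z')) +
    ((z ^+ p.+1 - z' ^+ p.+1) + (Q z - Q z')) by rewrite !QstarE; ring.
have e : abs (l / p%:R * (z ^+ p * (1 - z) - z' ^+ p * (1 - z'))) = P * abs (z - z').
  by rewrite absM abs_divp hl mulr1 main.
rewrite absD_dom// e; apply: le_lt_trans (_ : abs (z - z') < _); last first.
  by rewrite ltr_pMl// P_gt1.
apply: absD_le => //; apply: le_trans (Q_lip _ _) _; rewrite ?az ?az'//.
by rewrite ler_piMl// ltW// c_lt1.
Qed.

(** The parameter contributes P |l - l'| |1 - z|, which is smaller than P |z - z'| because |1 - z| <
    1. *)
Lemma Qstar_expand2 l l' z z' : abs l' = 1 -> abs (z - 1) < 1 -> abs (z' - 1) < 1 ->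
  abs (l - l') <= abs (z - z') ->
  abs (Qstar p l Q z - Qstar p l' Q z') = P * abs (z - z').
Proof.
move=> hl hz hz' hll; have [e|nzz] := eqVneq z z'.
  move: hll; rewrite e subrr abs0 => h.
  have /eqP : abs (l - l') = 0 by apply/eqP; rewrite eq_le h abs_ge0.
  rewrite mulr0 => /eqP /abs_eq0/eqP; rewrite subr_eq0 => /eqP ->.
  by rewrite subrr abs0.
have d0 : 0 < abs (z - z') by rewrite abs_gt0 subr_eq0.
rewrite Qstar_sub addrC absD_dom (Qstar_expand hl hz hz')//.
rewrite absM abs_divp absM absX (abs_near1 hz) expr1n mul1r -mulrA.
rewrite ltr_pM2l ?P_gt0//; apply: le_lt_trans (_ : abs (z - z') * abs (1 - z) < _).
  by rewrite ler_wpM2r.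
by rewrite gtr_pMr// abs_subC.
Qed.

(** The leading term has absolute value P |1 - z| on E and the rest at most 1, so |z - 1| = 1/P is
    the threshold for leaving the unit disc; [Qstar_near1_gt] is the other side. *)
Lemma Qstar_near1_le l z : abs l = 1 -> abs (z - 1) <= P^-1 -> abs (Qstar p l Q z) <= 1.
Proof.
move=> hl hz; have iP1 : P^-1 < 1 by rewrite invf_lt1 ?P_gt1 ?P_gt0.
have az := abs_near1 (le_lt_trans hz iP1).
rewrite QstarE; apply: absD_le; last by rewrite (le_trans (Q_le _)) ?az// ltW// c_lt1.
apply: absD_le; last by rewrite absX az expr1n.
rewrite absM abs_divp hl absM absX az expr1n mulr1 mul1r abs_subC.
by rewrite -ler_pdivlMl ?P_gt0// mulr1.
Qed.

Lemma Qstar_near1_gt l z : abs l = 1 -> P^-1 < abs (z - 1) < 1 ->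
  1 < abs (Qstar p l Q z).
Proof.
move=> hl /andP[hz1 hz2]; have az := abs_near1 hz2.
have gt1 : 1 < abs (l / p%:R * (z ^+ p * (1 - z))).
  rewrite absM abs_divp hl absM absX az expr1n mulr1 mul1r abs_subC.
  by rewrite -ltr_pdivrMl ?P_gt0// mulr1.
rewrite QstarE -addrA absD_dom//; apply: le_lt_trans gt1.
apply: absD_le; first by rewrite absX az expr1n.
by rewrite (le_trans (Q_le _)) ?az// ltW// c_lt1.
Qed.

Variables (y : nat -> K) (th : R).
Hypothesis y0E : y 0 = 1.
Hypothesis yS : forall k, y k.+1 ^+ p = p%:R * y k.
Hypothesis th_lt1 : th < 1.
Hypothesis iP_le_th : P^-1 <= th.
Hypothesis y1_le_th : abs (y 1) <= th.
Hypothesis c_le_th : c <= th.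

Local Notation U k z := (abs (z - y k) < abs (y k)).

Lemma th_gt0 : 0 < th.
Proof. by apply: lt_le_trans iP_le_th; rewrite invr_gt0 P_gt0. Qed.

Lemma abs_yS k : P * abs (y k.+1) ^+ p = abs (y k).
Proof. by rewrite -absX yS absM absp mulrA divff ?mul1r// gt_eqF ?P_gt0. Qed.

(** By [rhoXp], rho is fixed by x -> P x^p, an increasing map that sends |y_{k+1}| to |y_k|. *)
Lemma y_gt_rho k : rho < abs (y k).
Proof.
elim: k => [|k IH]; first by rewrite y0E abs1 rho_lt1.
rewrite -(@ltr_pXn2r _ p) ?nnegrE ?abs_ge0 ?(ltW rho_gt0) ?prime_gt0//.
by rewrite -(ltr_pM2l P_gt0) rhoXp abs_yS.
Qed.

Lemma y_gt0 k : 0 < abs (y k).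
Proof. exact: lt_trans rho_gt0 (y_gt_rho k). Qed.

Lemma y_anti k : abs (y k.+1) <= abs (y k).
Proof.
rewrite -(abs_yS k) -(prednK (prime_gt0 hp)) exprSr mulrA ler_peMl//.
rewrite -{1}rhoE ler_wpM2l ?(ltW P_gt0)// lerXn2r ?nnegrE ?(ltW rho_gt0)//.
exact: ltW (y_gt_rho _).
Qed.

Lemma yS_le_th k : abs (y k.+1) <= th.
Proof. by elim: k => [//|k]; apply: le_trans (y_anti _). Qed.

Lemma y_le1 k : abs (y k) <= 1.
Proof. by case: k => [|k]; rewrite ?y0E ?abs1// (le_trans (yS_le_th k))// ltW. Qed.

Lemma U_abs k z : U k z -> abs z = abs (y k).
Proof. exact: abs_near. Qed.

Lemma U_le1 k z : U k z -> abs z <= 1.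
Proof. by move=> /U_abs ->; exact: y_le1. Qed.

Lemma U0 z : U 0 z = (abs (z - 1) < 1).
Proof. by rewrite y0E abs1. Qed.

Lemma US_notin k z : U k.+1 z -> ~~ (abs (z - 1) < 1).
Proof.
move=> /U_abs hz; apply/negP => /abs_near1 e; have := le_lt_trans (yS_le_th k) th_lt1.
by rewrite -hz e ltxx.
Qed.

(** Exact because |1 - z| = 1 here. Applied to a difference of parameters, it gives the exact
    displacement used in [initial_state] and [stage]. *)
Lemma abs_main k l z : U k.+1 z ->
  abs (l / p%:R * (z ^+ p * (1 - z))) = abs l * abs (y k).
Proof.
move=> hz; have az := U_abs hz.
have z1 : abs z < 1 by rewrite az (le_lt_trans (yS_le_th k)).
rewrite absM abs_divp absM absX az (_ : abs (1 - z) = 1); last first.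
  by rewrite absD_dom ?abs1// absN.
by rewrite mulr1 mulrAC abs_yS mulrC.
Qed.

(** Since y_k = y_{k+1}^p / p, compare l z^p / p with it by replacing l with 1 and then z with
    y_{k+1}; each error is below |y_k|, and Q is bounded by c < rho < |y_k|. *)
Lemma Qstar_U k l z : inD l -> U k.+1 z -> U k (Qstar p l Q z).
Proof.
move=> hl hz; have az := U_abs hz; have yk := y_gt0 k; have yk1 := y_gt0 k.+1.
have z1 : abs z < 1 by rewrite az (le_lt_trans (yS_le_th k)).
have p0 := p_neq0; have zp : P * abs z ^+ p = abs (y k) by rewrite az abs_yS.
have -> : Qstar p l Q z - y k = (l - 1) / p%:R * z ^+ p +
   (z ^+ p - y k.+1 ^+ p) / p%:R - (l / p%:R * z ^+ p * z) + z ^+ p * z + Q z.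
  by rewrite /Qstar yS exprSr; field.
apply: absD_lt; last first.
  apply: le_lt_trans (Q_le (ltW z1)) _.
  exact: lt_trans c_lt_rho (y_gt_rho _).
have lt1 : abs (l / p%:R * z ^+ p * z) < abs (y k).
  rewrite absM absM abs_divp absX (abs_near1 hl) mulr1 zp.
  by rewrite gtr_pMr.
apply: absD_lt; last first.
  apply: le_lt_trans lt1; rewrite absM [leRHS]absM absM abs_divp (abs_near1 hl) mulr1.
  by rewrite ler_wpM2r// ler_peMl// ltW// P_gt1.
apply: absB_lt => //; apply: absD_lt.
  by rewrite absM abs_divp absX mulrAC zp mulrC gtr_pMl.
set t := abs (z - y k.+1) / abs (y k.+1).
have t0 : 0 <= t by rewrite divr_ge0.
have t1 : t < 1 by rewrite ltr_pdivrMr// mul1r.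
rewrite abs_divp.
have -> : z ^+ p = (y k.+1 + (z - y k.+1)) ^+ p by rewrite addrC subrK.
rewrite -[in ltRHS]abs_yS ltr_pM2l ?P_gt0//.
apply: le_lt_trans (_ : Num.max t P^-1 * t * abs (y k.+1) ^+ p < _).
  by apply: absXD_sub; rewrite ?t0 ?(ltW t1)// divfK// gt_eqF.
rewrite gtr_pMl ?exprn_gt0// mulr_ilt1// ?le_max ?t0// gt_max t1 invf_lt1 ?P_gt0//.
exact: P_gt1.
Qed.

(** Carries the boundary point of a [state] along, as [Qstar_U] carries its disc. *)
Lemma Qstar_small k l z : abs l = 1 -> abs z < abs (y k.+1) ->
  abs (Qstar p l Q z) < abs (y k).
Proof.
move=> hl hz; have z1 : abs z < 1 by rewrite (lt_le_trans hz)// y_le1.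
have zp : abs (l / p%:R * z ^+ p) < abs (y k).
  rewrite absM abs_divp hl mulr1 absX -abs_yS ltr_pM2l ?P_gt0//.
  by rewrite ltr_pXn2r ?nnegrE// prime_gt0.
rewrite QstarE; apply: absD_lt; last first.
  by rewrite (le_lt_trans (Q_le (ltW z1)))// (lt_trans c_lt_rho)// y_gt_rho.
apply: absD_lt.
  rewrite mulrA absM; apply: le_lt_trans zp; rewrite ler_piMr//.
  by apply: absB_le; rewrite ?abs1// ltW.
apply: le_lt_trans zp; rewrite absM abs_divp hl mulr1 !absX exprS.
by rewrite ler_wpM2r ?exprn_ge0// (le_trans (ltW z1))// ltW// P_gt1.
Qed.

(** Each term gains a factor at most th: z^p / p by [absXD_sub], z^(p+1) / p through |y_{k+1}| <=
    th, and Q through its Lipschitz constant c. *)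
Lemma Qstar_U_contract k l z z' t : abs l = 1 -> U k.+1 z -> U k.+1 z' ->
  0 <= t <= th -> abs (z - z') <= t * abs (y k.+1) ->
  abs (Qstar p l Q z - Qstar p l Q z') <= th * t * abs (y k).
Proof.
move=> hl hz hz' /andP[t0 tth] hzz; have az := U_abs hz; have az' := U_abs hz'.
have z1 := U_le1 hz; have z1' := U_le1 hz'; have yk := y_gt0 k; have P0 := P_gt0.
have yk1 := y_gt0 k.+1.
have -> : Qstar p l Q z - Qstar p l Q z' = l / p%:R * (z ^+ p - z' ^+ p) -
    l / p%:R * (z ^+ p.+1 - z' ^+ p.+1) + (z ^+ p.+1 - z' ^+ p.+1) + (Q z - Q z').
  by rewrite /Qstar; ring.
apply: absD_le; last first.
  apply: le_trans (Q_lip z1 z1') _; rewrite -mulrA ler_pM//.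
  by apply: le_trans hzz _; rewrite ler_wpM2l// y_anti.
have hp1 : abs (l / p%:R * (z ^+ p.+1 - z' ^+ p.+1)) <= th * t * abs (y k).
  rewrite subrXX mulrCA absM; apply: le_trans (_ : t * th * abs (y k) <= _); last first.
    by rewrite [t * th]mulrC.
  apply: ler_pM => //.
    by apply: le_trans hzz _; rewrite ler_wpM2l// yS_le_th.
  rewrite absM abs_divp hl mulr1 -abs_yS ler_wpM2l ?(ltW P0)//.
  apply: abs_sum => [|i _]; first by rewrite exprn_ge0.
  by rewrite absM !absX az az' -exprD subnK// -ltnS.
apply: absD_le; last first.
  apply: le_trans hp1; rewrite [leRHS]absM abs_divp hl mulr1.
  by rewrite ler_peMl// ltW// P_gt1.
apply: absB_le => //; rewrite absM abs_divp hl mulr1.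
have -> : z ^+ p - z' ^+ p = (z' + (z - z')) ^+ p - z' ^+ p by rewrite (addrC z') subrK.
apply: le_trans (_ : P * (Num.max t P^-1 * t * abs z' ^+ p) <= _).
  rewrite ler_wpM2l ?(ltW P0)// absXD_sub// ?t0 ?(le_trans tth) ?(ltW th_lt1)//.
  by rewrite az'.
rewrite mulrCA az' abs_yS ler_wpM2r// ler_wpM2r// ge_max tth.
exact: iP_le_th.
Qed.

Lemma iter_U l k z i : inD l -> U k z -> (i <= k)%N ->
  U (k - i) (iter i (Qstar p l Q) z).
Proof.
move=> hl hz; elim: i => [|i IH] ik; first by rewrite subn0.
rewrite iterS; apply: Qstar_U => //.
by rewrite -subSn// subSS; apply: IH; apply: ltnW.
Qed.

Lemma iter_lip l l' z z' b n : inD l' ->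
  (forall j, (j < n)%N -> abs (iter j (Qstar p l Q) z) <= 1) ->
  (forall j, (j < n)%N -> abs (iter j (Qstar p l' Q) z') <= 1) ->
  abs (l - l') <= b -> abs (z - z') <= b ->
  abs (iter n (Qstar p l Q) z - iter n (Qstar p l' Q) z') <= P ^+ n * b.
Proof.
move=> hl h h' hll hzz; have b0 := le_trans (abs_ge0 _) hll.
elim: n h h' => [|n IH] h h'; first by rewrite mul1r.
rewrite !iterS exprS -mulrA; apply: Qstar_lip2.
- by rewrite (abs_near1 hl).
- exact: h.
- exact: h'.
- by apply: le_trans hll _; rewrite ler_peMl// exprn_ege1// ltW// P_gt1.
- by apply: IH => j jn; [apply: h | apply: h']; apply: ltnW.
Qed.

Lemma iter_expand l l' z z' n : inD l' -> abs (l - l') <= abs (z - z') ->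
  (forall j, (j < n)%N -> U 0 (iter j (Qstar p l Q) z)) ->
  (forall j, (j < n)%N -> U 0 (iter j (Qstar p l' Q) z')) ->
  abs (iter n (Qstar p l Q) z - iter n (Qstar p l' Q) z') = P ^+ n * abs (z - z').
Proof.
move=> hl hll; elim: n => [|n IH] h h'; first by rewrite mul1r.
have e : abs (iter n (Qstar p l Q) z - iter n (Qstar p l' Q) z') = P ^+ n * abs (z - z').
  by apply: IH => j jn; [apply: h | apply: h']; apply: ltnW.
rewrite !iterS Qstar_expand2 ?(abs_near1 hl) -?U0 ?h ?h'// e ?exprS ?mulrA//.
by apply: le_trans hll _; rewrite ler_peMl// exprn_ege1// ltW// P_gt1.
Qed.

Lemma Qstar_U_contract2 k l l' z z' t : inD l -> inD l' -> U k.+1 z -> U k.+1 z' ->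
  0 <= t <= th -> abs (z - z') <= t * abs (y k.+1) ->
  abs (Qstar p l Q z - Qstar p l' Q z') <= Num.max (abs (l - l')) (th * t) * abs (y k).
Proof.
move=> hl hl' hz hz' ht hzz; rewrite Qstar_sub; apply: absD_le.
  by rewrite (abs_main _ hz) ler_wpM2r// le_max lexx.
apply: le_trans (Qstar_U_contract _ hz hz' ht hzz) _; first by rewrite (abs_near1 hl').
by rewrite ler_wpM2r// le_max lexx orbT.
Qed.

(** The initial separation shrinks by th at each step, while the parameters inject |l - l'| anew;
    the maximum of the two bounds the relative distance. *)
Lemma iter_contract k l l' z z' t i : inD l -> inD l' -> U k z -> U k z' ->
  abs (l - l') <= t <= th -> abs (z - z') <= t * abs (y k) -> (i <= k)%N ->
  abs (iter i (Qstar p l Q) z - iter i (Qstar p l' Q) z')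
    <= Num.max (abs (l - l')) (th ^+ i * t) * abs (y (k - i)).
Proof.
move=> hl hl' hz hz' /andP[dt tth] hzz; have d0 := abs_ge0 (l - l').
have t0 := le_trans d0 dt; have th0 := ltW th_gt0; have th1 := ltW th_lt1.
elim: i => [|i IH] ik.
  by rewrite subn0 (max_idPr _) mul1r.
have hi : Num.max (abs (l - l')) (th ^+ i * t) <= t.
  by rewrite ge_max dt ler_piMl// exprn_ile1.
have hi0 : 0 <= Num.max (abs (l - l')) (th ^+ i * t) by rewrite le_max d0.
have kE : (k - i = (k - i.+1).+1)%N by rewrite -subSn.
rewrite !iterS; apply: le_trans (@Qstar_U_contract2 (k - i.+1) l l' _ _
  (Num.max (abs (l - l')) (th ^+ i * t)) hl hl' _ _ _ _) _.
- by rewrite -kE; apply: iter_U => //; apply: ltnW.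
- by rewrite -kE; apply: iter_U => //; apply: ltnW.
- by rewrite hi0 (le_trans hi).
- by rewrite -kE; apply: IH; apply: ltnW.
rewrite ler_wpM2r// exprS -mulrA maxr_pMr// !ge_max le_max lexx /=.
by rewrite !le_max lexx orbT andbT ler_piMl.
Qed.

(** * Parameter discs *)

Hypothesis Q_approx : forall e : R, 0 < e ->
  exists q : {poly K}, forall z, abs z <= 1 -> abs (Q z - q.[z]) < e.

(** Polynomial parameter and starting point cover both uses: varying the parameter (['X], constant)
    and varying the point (constant, ['X]). *)
Definition orbit (ell x : {poly K}) n s := iter n (Qstar p ell.[s] Q) x.[s].

Lemma orbit_approx ell x n e : 0 < e -> exists g : {poly K}, forall s,
  abs ell.[s] <= 1 -> (forall j, (j < n)%N -> abs (orbit ell x j s) <= 1) ->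
  abs (orbit ell x n s - g.[s]) < e.
Proof.
elim: n e => [|n IH] e e0.
  by exists x => s _ _; rewrite subrr abs0.
(* Dividing by P absorbs the expansion of the next step; the cap at 1 keeps g(s) in the unit disc,
   where q approximates Q. *)
have e1 : 0 < Num.min e 1 / P by rewrite divr_gt0 ?P_gt0// lt_min e0 ltr01.
have [g hg] := IH _ e1; have [q hq] := Q_approx e0.
exists (p%:R^-1 *: ell * (g ^+ p * (1%:P - g)) + g ^+ p.+1 + (q \Po g)) => s hl h.
have hn := h n (ltnSn n).
have hgn : abs (orbit ell x n s - g.[s]) < Num.min e 1 / P.
  by apply: hg => // j jn; apply: h; apply: ltnW.
have gs : abs g.[s] <= 1.
  rewrite -[g.[s]](subKr (orbit ell x n s)); apply: absB_le => //.
  apply: le_trans (ltW hgn) _; rewrite ler_pdivrMr ?P_gt0// mul1r ge_min.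
  by rewrite (ltW P_gt1) orbT.
rewrite /orbit iterS -/(orbit ell x n s).
have -> : (p%:R^-1 *: ell * (g ^+ p * (1%:P - g)) + g ^+ p.+1 + (q \Po g)).[s] =
    Qstar p ell.[s] Q g.[s] - (Q g.[s] - q.[g.[s]]).
  by rewrite QstarE !(hornerD, hornerN, hornerM, hornerZ, hornerC, horner_exp, horner_comp); ring.
rewrite opprD opprK addrA; apply: absD_lt; last exact: hq.
apply: le_lt_trans (Qstar_lip hl hn gs) _; rewrite mulrC -ltr_pdivlMr ?P_gt0//.
by apply: lt_le_trans hgn _; rewrite ler_pM2r ?invr_gt0 ?P_gt0// ge_min lexx.
Qed.

(** The disc V of the overview has centre m and radius |m - v|. Since v lies outside this open disc,
    the last clause includes it separately, so that polynomial approximation holds at v too. *)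
Definition state ell x n m v k := [/\ m != v, abs (orbit ell x n v) < abs (y k),
  forall s, abs (s - m) < abs (m - v) -> U k (orbit ell x n s) &
  forall s, abs (s - m) < abs (m - v) \/ s = v ->
    inD ell.[s] /\ forall j, (j < n)%N -> abs (orbit ell x j s) <= 1].

(** The point z, mapped outside U_k, forces a zero of the approximating polynomial within |m - z| of
    m; v is a zero nearest to m. *)
Lemma state_create ell x n k m z r : abs (m - z) < r ->
  (forall s, abs (s - m) < r ->
    inD ell.[s] /\ forall j, (j < n)%N -> abs (orbit ell x j s) <= 1) ->
  U k (orbit ell x n m) -> abs (y k) <= abs (orbit ell x n z - y k) ->
  exists2 v, abs (m - v) < r & state ell x n m v k.
Proof.
move=> mz hV hm hz; have yk := y_gt0 k.
have [g hg] := orbit_approx ell x n yk.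
have gV s : abs (s - m) < r -> abs (orbit ell x n s - g.[s]) < abs (y k).
  by move=> /hV [hl hj]; apply: hg => //; rewrite (abs_near1 hl).
have r0 : 0 < r by apply: le_lt_trans mz.
have mV : abs (m - m) < r by rewrite subrr abs0.
have zV : abs (z - m) < r by rewrite abs_subC.
have gm : abs (g.[m] - y k) < abs (y k).
  by apply: abs_dist_lt hm; rewrite abs_subC gV.
have agm := abs_near gm.
have [] := @poly_nearest_root g m z.
- by rewrite -abs_gt0 agm.
- rewrite agm leNgt; apply: contraL hz => h; rewrite -ltNge.
  by apply: abs_dist_lt (gV _ zV) _; apply: abs_dist_lt h gm.
move=> v [gv0 mvz hv]; have mv := le_lt_trans mvz mz.
have sub s : abs (s - m) < abs (m - v) -> abs (s - m) < r by move=> /lt_trans; apply.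
exists v => //; split.
- by apply: contraTneq gm => e; rewrite e gv0 sub0r absN ltxx.
- by have := gV v; rewrite gv0 subr0 abs_subC; apply.
- move=> s hs; apply: abs_dist_lt (gV _ (sub _ hs)) _.
  by apply: abs_dist_lt gm; rewrite -agm; apply: hv.
- by move=> s [/sub|->]; [exact: hV | apply: hV; rewrite abs_subC].
Qed.

Lemma state_contract ell x n m v k : state ell x n m v k.+1 -> state ell x n.+1 m v k.
Proof.
move=> [mv hv hU hj]; split=> //.
- by rewrite /orbit iterS Qstar_small// abs_near1//; case: (hj v (or_intror erefl)).
- move=> s hs; rewrite /orbit iterS; apply: Qstar_U; last exact: hU.
  by case: (hj s (or_introl hs)).
move=> s hs; have [hl hjs] := hj s hs; split=> // j.
rewrite ltnS leq_eqVlt => /predU1P[->|/hjs//].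
by case: hs => [/hU/U_le1//|->]; apply: le_trans (ltW hv) (y_le1 _).
Qed.

Lemma state_contract_iter ell x n m v k : state ell x n m v k -> state ell x (n + k) m v 0.
Proof.
elim: k n => [|k IH] n; first by rewrite addn0.
by move=> /state_contract/IH; rewrite addSnnS.
Qed.

Definition ball_sub (m' v' m v : K) :=
  forall s, abs (s - m') < abs (m' - v') -> abs (s - m) < abs (m - v).

(** The approximant g attains every value of E on V: for |u| < 1, g - (1 + u) is below 1 at m and of
    absolute value 1 at v. The values 1 and 1 + y_1 give points a, b whose next iterates lie inside
    and outside the unit disc; a point m' sent near y_k is then found by [poly_root_near], and
    [state_create] is applied with b. *)
Lemma state_expand ell x n m v k : state ell x n m v 0 -> exists m' v',
  [/\ state ell x n.+1 m' v' k, ball_sub m' v' m v & abs (m' - v') < abs (m - v)].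
Proof.
move=> [mv hv hU hj]; have mv0 : 0 < abs (m - v) by rewrite abs_gt0 subr_eq0.
have iP0 : 0 < P^-1 by rewrite invr_gt0 P_gt0.
have iP1 : P^-1 < 1 by rewrite invf_lt1 ?P_gt1 ?P_gt0.
have [g hg] := orbit_approx ell x n iP0.
have gV s : abs (s - m) < abs (m - v) \/ s = v -> abs (orbit ell x n s - g.[s]) < P^-1.
  by move=> /hj [hl hs]; apply: hg => //; rewrite (abs_near1 hl).
have mV : abs (m - m) < abs (m - v) by rewrite subrr abs0.
have g_val u : abs u < 1 -> exists a, [/\ abs (a - m) < abs (m - v) & g.[a] = 1 + u].
  move=> hu; have [] := @poly_root_near (g - (1 + u)%:P) m v.
    rewrite !hornerE; have -> : abs (g.[v] - (1 + u)) = 1.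
      have gv : abs g.[v] < 1.
        rewrite -[g.[v]](subKr (orbit ell x n v)); apply: absB_lt.
          by move: hv; rewrite y0E abs1.
        by apply: lt_trans iP1; apply: gV; right.
      rewrite -absN opprB -addrA absD_dom abs1//.
      by apply: absB_lt.
    rewrite opprD addrA; apply: absB_lt => //.
    apply: (@abs_dist_lt _ _ (orbit ell x n m)); last by rewrite -U0; exact: hU.
    by rewrite abs_subC; apply: lt_trans iP1; apply: gV; left.
  move=> a; rewrite !hornerE => /eqP; rewrite subr_eq0 => /eqP ga am.
  by exists a.
have [a [aV ga]] : exists a, [/\ abs (a - m) < abs (m - v) & g.[a] = 1 + 0].
  by apply: g_val; rewrite abs0 ltr01.
(* As |y_1|^p = 1/P and |y_1| < 1, the value 1 + y_1 is in the part of E that leaves the unit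
   disc. *)
have y1P : P^-1 < abs (y 1).
  have e : P^-1 = abs (y 1) ^+ p.
    by apply: (mulfI (lt0r_neq0 P_gt0)); rewrite abs_yS y0E abs1 divff// gt_eqF// P_gt0.
  rewrite [ltLHS]e -[ltRHS]expr1 ltr_iXn2l ?prime_gt1 ?y_gt0//.
  exact: le_lt_trans (yS_le_th 0) th_lt1.
have [b [bV gb]] : exists b, [/\ abs (b - m) < abs (m - v) & g.[b] = 1 + y 1].
  by apply: g_val; exact: le_lt_trans (yS_le_th 0) th_lt1.
have inDV s : abs (s - m) < abs (m - v) -> abs ell.[s] = 1.
  by move=> hs; apply: abs_near1; case: (hj s (or_introl hs)).
have Ha : abs (orbit ell x n.+1 a) <= 1.
  rewrite /orbit iterS; apply: Qstar_near1_le; first exact: inDV.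
  by have := gV a (or_introl aV); rewrite ga addr0 => /ltW.
have Hb : 1 < abs (orbit ell x n.+1 b).
  rewrite /orbit iterS; apply: Qstar_near1_gt; first exact: inDV.
  have := gV b (or_introl bV); rewrite gb /orbit opprD addrA => h.
  rewrite (abs_near (lt_trans h y1P)) y1P.
  exact: le_lt_trans (yS_le_th 0) th_lt1.
have yk := y_gt0 k; have [h hh] := orbit_approx ell x n.+1 yk.
have hn1 s : abs (s - m) < abs (m - v) ->
    inD ell.[s] /\ forall j, (j < n.+1)%N -> abs (orbit ell x j s) <= 1.
  move=> hs; have [hl hjs] := hj s (or_introl hs); split=> // j.
  rewrite ltnS leq_eqVlt => /predU1P[->|/hjs//]; exact: U_le1 (hU _ hs).
have hV s : abs (s - m) < abs (m - v) -> abs (orbit ell x n.+1 s - h.[s]) < abs (y k).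
  by move=> /hn1 [hl hs]; apply: hh => //; rewrite (abs_near1 hl).
have ha : abs (h.[a] - y k) <= 1.
  apply: absB_le (y_le1 _); rewrite -[h.[a]](subKr (orbit ell x n.+1 a)).
  by apply: absB_le => //; apply: le_trans (ltW (hV _ aV)) (y_le1 _).
have hb : 1 < abs (orbit ell x n.+1 b - y k).
  by rewrite absD_dom// absN (le_lt_trans (y_le1 _)).
have hb' : 1 < abs (h.[b] - y k).
  rewrite ltNge; apply: contraL hb => hb; rewrite -leNgt.
  by apply: abs_dist_le hb; apply: le_trans (ltW (hV _ bV)) (y_le1 _).
have [] := @poly_root_near (h - (y k)%:P) a b.
  by rewrite !hornerE; apply: le_lt_trans hb'.
move=> m'; rewrite !hornerE => /eqP; rewrite subr_eq0 => /eqP hm' m'a.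
have ab : abs (a - b) < abs (m - v).
  by apply: abs_dist_lt aV _; rewrite abs_subC.
have m'V : abs (m' - m) < abs (m - v) by apply: abs_dist_lt aV; apply: lt_trans ab.
have in_ball s : abs (s - m') < abs (m - v) -> abs (s - m) < abs (m - v).
  by move=> hs; apply: abs_dist_lt m'V.
have [] := @state_create ell x n.+1 k m' b (abs (m - v)).
- by apply: abs_dist_lt m'V _; rewrite abs_subC.
- by move=> s /in_ball/hn1.
- by have := hV _ m'V; rewrite hm'.
- exact: le_trans (y_le1 _) (ltW hb).
move=> v' m'v' st; exists m', v'; split=> // s hs.
by apply: in_ball; apply: lt_trans m'v'.
Qed.

Lemma state_run ell x n m v L : state ell x n m v 0 -> exists m' v',
  [/\ state ell x (n + L) m' v' 0, ball_sub m' v' m v & forall s,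
      abs (s - m') < abs (m' - v') -> forall j, (j <= L)%N -> U 0 (orbit ell x (n + j) s)].
Proof.
move=> st; elim: L => [|L [m' [v' [st' sub' hU']]]].
  exists m, v; split=> [|//|s hs j]; first by rewrite addn0.
  by rewrite leqn0 => /eqP ->; rewrite addn0; case: st => _ _ + _; apply.
have [m2 [v2 [st2 sub2 _]]] := state_expand 0 st'.
exists m2, v2; split=> [|s /sub2/sub'//|s hs j]; first by rewrite addnS.
rewrite leq_eqVlt => /predU1P[->|]; last by move=> jL; apply: hU' => //; apply: sub2.
by rewrite addnS; case: st2 => _ _ + _; apply.
Qed.

Lemma expr_small (q e : R) : 0 <= q < 1 -> 0 < e -> exists n, q ^+ n < e.
Proof.
move=> /andP[q0 q1] e0; have q1' : `|q| < 1 by rewrite ger0_norm.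
have /cvgrPdist_lt/(_ e e0)[N _ hN] := @cvg_expr R q q1'.
exists N; have := hN N (leqnn N); rewrite sub0r normrN ger0_norm//.
exact: exprn_ge0.
Qed.

Lemma iP_lt1 : 0 <= P^-1 < 1.
Proof. by rewrite invr_ge0 (ltW P_gt0) invf_lt1 ?P_gt1 ?P_gt0. Qed.

Lemma abs_pX n : abs (p%:R ^+ n) = P^-1 ^+ n.
Proof. by rewrite absX absp. Qed.

Lemma orbitXC x0 n s : orbit 'X x0%:P n s = iter n (Qstar p s Q) x0.
Proof. by rewrite /orbit hornerX hornerC. Qed.

Lemma orbitCX l n s : orbit l%:P 'X n s = iter n (Qstar p l Q) s.
Proof. by rewrite /orbit hornerX hornerC. Qed.

(** The parameter is fixed and the starting point varies; U_1 with boundary point 0 is a [state] at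
    time 0. *)
Lemma long_run_start l L : inD l -> exists x0, U 1 x0 /\
  forall j, (j <= L)%N -> U 0 (iter j.+1 (Qstar p l Q) x0).
Proof.
move=> hl; have st0 : state l%:P 'X 0 (y 1) 0 1.
  split.
  - by rewrite -abs_gt0 y_gt0.
  - by rewrite orbitCX /= abs0 y_gt0.
  - by move=> s; rewrite subr0 orbitCX.
  - by move=> s _; rewrite hornerC.
have [m' [v' [st sub hU]]] := state_run L (state_contract st0).
have m'V : abs (m' - m') < abs (m' - v').
  by case: st => + _ _ _; rewrite subrr abs0 abs_gt0 subr_eq0.
exists m'; split; first by have := sub _ m'V; rewrite subr0.
by move=> j jL; have := hU _ m'V _ jL; rewrite orbitCX add1n.
Qed.

(* Two parameters at distance p^-E have orbits separating by a factor p at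
   each step spent near 1, so the disc of parameters cannot be mapped near 1
   E + 1 times in a row. *)
Lemma initial_state l e : inD l -> 0 < e <= 1 -> exists x0 n m v,
  state 'X x0%:P n m v 0 /\ forall s, abs (s - m) < abs (m - v) -> abs (s - l) < e.
Proof.
move=> hl /andP[e0 e1]; have [E hE] := expr_small iP_lt1 e0.
have [x0 [x0U hx0]] := long_run_start E hl.
have inDV s : abs (s - l) < e -> inD s.
  by move=> hs; apply: abs_dist_lt hl; apply: lt_le_trans e1.
suff [//|near1] : (exists x0 n m v, state 'X x0%:P n m v 0 /\
      forall s, abs (s - m) < abs (m - v) -> abs (s - l) < e) \/
    (forall s, abs (s - l) < e ->
      forall j, (j <= E)%N -> U 0 (iter j.+1 (Qstar p s Q) x0)).
  (* In the second alternative l and l' contradict expansion: their orbits, P^-E apart after one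
     step, would be at distance 1 after E more steps in E. *)
  pose l' := l + p%:R ^+ E.
  have dl : abs (l' - l) = P^-1 ^+ E by rewrite /l' addrC addKr abs_pX.
  have l'V : abs (l' - l) < e by rewrite dl.
  have d1 : abs (Qstar p l' Q x0 - Qstar p l Q x0) = P^-1 ^+ E.
    by rewrite Qstar_sub subrr addr0 (abs_main _ x0U) dl y0E abs1 mulr1.
  have := @iter_expand l' l (Qstar p l' Q x0) (Qstar p l Q x0) E hl.
  rewrite dl d1 lexx -exprMn divff ?lt0r_neq0 ?P_gt0// expr1n -!iterSr.
  have hU s : abs (s - l) < e ->
      forall j, (j < E)%N -> U 0 (iter j (Qstar p s Q) (Qstar p s Q x0)).
    by move=> hs j jE; rewrite -iterSr; apply: near1 => //; apply: ltnW.
  have lV : abs (l - l) < e by rewrite subrr abs0.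
  move=> /(_ isT (hU _ l'V) (hU _ lV)) h.
  have := near1 _ l'V _ (leqnn E); have := near1 _ lV _ (leqnn E).
  rewrite y0E abs1 abs_subC => h1 h2.
  by have := abs_dist_lt h2 h1; rewrite h ltxx.
(* At the first time some parameter z leaves E, the orbit for l is still in E, and [state_create]
   applies with centre l. *)
elim: {-2}E (leqnn E) => [|J IH] JE.
  right=> s hs j; rewrite leqn0 => /eqP -> /=; apply: Qstar_U => //.
  exact: inDV.
have [|hJ] := IH (ltnW JE); first by left.
have [hall|/existsNP[z /not_implyP[zV hz]]] := pselect (forall s, abs (s - l) < e ->
    U 0 (iter J.+2 (Qstar p s Q) x0)).
  right=> s hs j; rewrite leq_eqVlt => /predU1P[->|]; first exact: hall.
  by rewrite ltnS; apply: hJ.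
left; have [] := @state_create 'X x0%:P J.+2 0 l z e.
- by rewrite abs_subC.
- move=> s hs; rewrite hornerX; split; first exact: inDV.
  move=> [|j] jJ; rewrite orbitXC; first exact: U_le1 x0U.
  by apply: (@U_le1 0); apply: hJ.
- by rewrite orbitXC; apply: hx0.
- by rewrite orbitXC leNgt; apply/negP.
move=> v lv st; exists x0, J.+2, l, v; split=> // s /lt_trans; exact.
Qed.

(** * Stages of the itinerary and the limiting parameter *)

Variables (sg : R).
Hypothesis sg_gt0 : 0 < sg.
Hypothesis P_sg : P * sg <= th * rho.

Lemma sg_lt1 : sg < 1.
Proof.
apply: le_lt_trans (_ : th * rho < 1); last first.
  by rewrite mulr_ilt1 ?(ltW rho_gt0) ?(ltW th_gt0) ?rho_lt1.
by apply: le_trans P_sg; rewrite ler_peMl ?ltW ?P_gt1.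
Qed.

(** The run length M is chosen first, then k so large that the contraction beats P^M. If the new
    radius exceeded P^-M, two parameters at that distance would have orbits exactly P^-M apart on
    returning to E, hence at distance 1 after M steps in E, which is impossible. *)
Lemma stage x0 N m v : state 'X x0%:P N m v 0 -> exists k M m' v',
  [/\ [/\ (0 < k)%N, (N <= M)%N & P ^+ M * th ^+ k <= sg],
      state 'X x0%:P (N.+1 + k + M) m' v' 0,
      ball_sub m' v' m v, abs (m' - v') <= P^-1 ^+ N & forall s,
      abs (s - m') < abs (m' - v') -> [/\ U k (iter N.+1 (Qstar p s Q) x0),
        forall j, (j <= M)%N -> U 0 (iter (N.+1 + k + j) (Qstar p s Q) x0) &
        U 0 (iter N (Qstar p s Q) x0)]].
Proof.
move=> st; have [e0 he0] := expr_small iP_lt1 sg_gt0.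
have P0 := P_gt0; have P1 := ltW P_gt1; have th0 := th_gt0; have th1 := th_lt1.
pose M := (N + e0)%N.
have [k hk] : exists k, th ^+ k < sg / P ^+ M.
  by apply: expr_small; rewrite ?(ltW th0) ?th1// divr_gt0// exprn_gt0.
have {}hk : P ^+ M * th ^+ k <= sg by rewrite mulrC -ler_pdivlMr ?exprn_gt0// ltW.
have [m1 [v1 [st1 sub1 _]]] := state_expand k.+1 st.
have [m2 [v2 [st2 sub2 hU2]]] := state_run M (state_contract_iter st1).
have hU s : abs (s - m2) < abs (m2 - v2) -> [/\ U k.+1 (iter N.+1 (Qstar p s Q) x0),
    forall j, (j <= M)%N -> U 0 (iter (N.+1 + k.+1 + j) (Qstar p s Q) x0) &
    U 0 (iter N (Qstar p s Q) x0)].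
  move=> hs; split.
  - by case: st1 => _ _ /(_ _ (sub2 _ hs)) + _; rewrite orbitXC.
  - by move=> j jM; have := hU2 _ hs _ jM; rewrite orbitXC.
  - by case: st => _ _ /(_ _ (sub1 _ (sub2 _ hs))) + _; rewrite orbitXC.
exists k.+1, M, m2, v2; split=> //.
- split=> //; first exact: leq_addr.
  apply: le_trans hk; rewrite ler_wpM2l ?exprn_ge0 ?(ltW P0)//.
  by rewrite exprS ler_piMl ?exprn_ge0 ?(ltW th0) ?(ltW th1).
- by move=> s /sub2/sub1.
have /andP[q0 q1] := iP_lt1.
have iPM : P^-1 ^+ M <= P^-1 ^+ N.
  by rewrite exprD ler_piMr ?exprn_ge0// exprn_ile1// ltW.
apply: le_trans iPM; rewrite leNgt; apply/negP => far.
pose d := P^-1 ^+ M; pose l := m2 + p%:R ^+ M.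
have d0 : 0 < d by rewrite exprn_gt0 ?invr_gt0.
have dl : abs (l - m2) = d by rewrite /l addrC addKr abs_pX.
have lV : abs (l - m2) < abs (m2 - v2) by rewrite dl.
have mV : abs (m2 - m2) < abs (m2 - v2) by rewrite subrr abs0 (lt_trans d0).
have inDV s : abs (s - m2) < abs (m2 - v2) -> inD s.
  by case: st2 => _ _ _ + hs => /(_ _ (or_introl hs)) []; rewrite hornerX.
have leV s : abs (s - m2) < abs (m2 - v2) ->
    forall j, (j < N.+1)%N -> abs (iter j (Qstar p s Q) x0) <= 1.
  move=> hs j; rewrite ltnS leq_eqVlt => /predU1P[->|jN].
    by have [_ _ /U_le1] := hU s hs.
  case: st => _ _ _ /(_ _ (or_introl (sub1 _ (sub2 _ hs)))) [_ /(_ j jN)].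
  by rewrite orbitXC.
have [lU lU0 _] := hU _ lV; have [mU mU0 _] := hU _ mV.
(* A bound for the relative distance of the two orbits on entering U_k; the summand e0 in M makes it
   at most th. *)
pose t := P ^+ N.+1 * d / rho.
have r0 := rho_gt0.
have dt : d <= t.
  rewrite /t mulrAC ler_peMl ?(ltW d0)// ler_pdivlMr// mul1r.
  by apply: le_trans (ltW rho_lt1) _; rewrite exprn_ege1.
have tE : P ^+ N.+1 * d = P * P^-1 ^+ e0.
  rewrite /d exprD mulrA exprS -(mulrA P (P ^+ N)) -exprMn divff ?lt0r_neq0//.
  by rewrite expr1n mulr1.
have tth : t <= th.
  rewrite /t ler_pdivrMr// tE; apply: le_trans P_sg.
  by rewrite ler_wpM2l ?(ltW P0)// ltW.
have Dy : abs (iter N.+1 (Qstar p l Q) x0 - iter N.+1 (Qstar p m2 Q) x0)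
    <= t * abs (y k.+1).
  apply: le_trans (iter_lip (inDV _ mV) (leV _ lV) (leV _ mV) (_ : _ <= d) _) _.
  - by rewrite dl.
  - by rewrite subrr abs0 ltW.
  by rewrite /t -mulrA ler_peMr ?mulr_ge0 ?exprn_ge0 ?(ltW P0) ?(ltW d0)// mulrC
     ler_pdivlMr// mul1r ltW// y_gt_rho.
(* Stopping in U_1, one step before E, leaves a last step in which the parameter term is exactly d
   and the point term is below d. *)
have Dk : abs (iter k (Qstar p l Q) (iter N.+1 (Qstar p l Q) x0) -
    iter k (Qstar p m2 Q) (iter N.+1 (Qstar p m2 Q) x0)) <= d * abs (y 1).
  apply: le_trans (iter_contract (inDV _ lV) (inDV _ mV) lU mU _ Dy (leqnSn k)) _.
    by rewrite dl dt.
  rewrite subSnn ler_wpM2r// dl ge_max lexx /= /t.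
  have : P ^+ M * th ^+ k * P <= rho.
    apply: le_trans (_ : sg * P <= _); first by rewrite ler_wpM2r ?(ltW P0).
    by rewrite mulrC (le_trans P_sg)// ler_piMl ?ltW.
  move=> h; rewrite mulrA ler_pdivrMr// mulrA [d * rho]mulrC ler_wpM2r ?(ltW d0)//.
  apply: le_trans h; rewrite exprSr mulrA ler_wpM2r ?(ltW P0)//.
  by rewrite mulrC ler_wpM2r ?exprn_ge0 ?(ltW th0)// ler_weXn2l// leq_addr.
have [U1l U1m] : U 1 (iter k (Qstar p l Q) (iter N.+1 (Qstar p l Q) x0)) /\
    U 1 (iter k (Qstar p m2 Q) (iter N.+1 (Qstar p m2 Q) x0)).
  by rewrite -[1%N](subSnn k); split; apply: iter_U => //; apply: inDV.
have D0 : abs (iter (N.+1 + k.+1) (Qstar p l Q) x0 -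
    iter (N.+1 + k.+1) (Qstar p m2 Q) x0) = d.
  rewrite [(N.+1 + _)%N]addnC !iterD 2!iterS Qstar_sub absD_dom.
    by rewrite (abs_main _ U1l) dl y0E abs1 mulr1.
  rewrite (abs_main _ U1l) dl y0E abs1 mulr1.
  apply: le_lt_trans (Qstar_U_contract _ U1l U1m (_ : 0 <= d <= th) Dk) _.
  - by rewrite abs_near1// inDV.
  - by rewrite ltW//= (le_trans dt).
  - by rewrite y0E abs1 mulr1 gtr_pMl.
have := @iter_expand l m2 _ _ M (inDV _ mV) (_ : _ <=
  abs (iter (N.+1 + k.+1) (Qstar p l Q) x0 - iter (N.+1 + k.+1) (Qstar p m2 Q) x0)).
rewrite D0 dl lexx => /(_ isT) h.
have {h} : abs (iter M (Qstar p l Q) (iter (N.+1 + k.+1) (Qstar p l Q) x0) -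
    iter M (Qstar p m2 Q) (iter (N.+1 + k.+1) (Qstar p m2 Q) x0)) = P ^+ M * d.
  by apply: h => j jM; rewrite -iterD addnC; [apply: lU0 | apply: mU0]; apply: ltnW.
rewrite /d -exprMn divff ?lt0r_neq0// expr1n -!iterD [(M + _)%N]addnC => h.
have := lU0 _ (leqnn M); have := mU0 _ (leqnn M).
rewrite y0E abs1 => h1 h2; rewrite abs_subC in h1.
by have := abs_dist_lt h2 h1; rewrite h ltxx.
Qed.

Hypothesis K_complete : forall u, kcauchy abs u -> exists l, kcvg abs u l.

(** At time N i the orbit jumps from E into U_(k i), and M i is the length of its next run in E. The
    bound by sg controls nearby points; N i <= M i makes the runs unbounded. *)
Definition scheduled (z : nat -> K) (N k M : nat -> nat) :=
  (forall j, (j < N 0)%N -> abs (z j) <= 1) /\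
  forall i, [/\ N i.+1 = ((N i).+1 + k i + M i)%N, (0 < k i)%N, (N i <= M i)%N,
    P ^+ M i * th ^+ k i <= sg &
    [/\ U 0 (z (N i)), U (k i) (z (N i).+1) &
      forall j, (j <= M i)%N -> U 0 (z ((N i).+1 + k i + j)%N)]].

(** Stages are iterated by choice. The centres are Cauchy because the radii are at most P^-(N i)
    with N i >= i, and the limit stays in every open ball since these are closed too. *)
Lemma schedule_exists l e : inD l -> 0 < e <= 1 -> exists x0 lam N k M,
  abs (lam - l) < e /\ scheduled (fun n => iter n (Qstar p lam Q) x0) N k M.
Proof.
move=> hl he; have [x0 [n0 [m0 [v0 [st0 sub0]]]]] := initial_state hl he.
pose S := {q : nat * K * K | state 'X x0%:P q.1.1 q.1.2 q.2 0}.
pose good (q q' : S) (kM : nat * nat) :=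
  let: (N, m, v) := sval q in let: (N', m', v') := sval q' in let: (k, M) := kM in
  [/\ [/\ (0 < k)%N, (N <= M)%N & P ^+ M * th ^+ k <= sg],
      N' = (N.+1 + k + M)%N,
      ball_sub m' v' m v, abs (m' - v') <= P^-1 ^+ N & forall s,
      abs (s - m') < abs (m' - v') -> [/\ U k (iter N.+1 (Qstar p s Q) x0),
        forall j, (j <= M)%N -> U 0 (iter (N.+1 + k + j) (Qstar p s Q) x0) &
        U 0 (iter N (Qstar p s Q) x0)]].
have [nxt hnxt] : {nxt : S -> S * (nat * nat) & forall q, good q (nxt q).1 (nxt q).2}.
  apply: (@choice _ _ (fun q r => good q r.1 r.2)) => -[[[N m] v] st].
  have [k [M [m' [v' [h1 st' h3 h4 h5]]]]] := stage st.
  by exists (exist _ (_, m', v') st', (k, M)); split.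
pose q i := iter i (fun r => (nxt r).1) (exist _ (n0, m0, v0) st0 : S).
pose N i := (sval (q i)).1.1; pose m i := (sval (q i)).1.2; pose v i := (sval (q i)).2.
pose k i := (nxt (q i)).2.1; pose M i := (nxt (q i)).2.2.
have hst i : state 'X x0%:P (N i) (m i) (v i) 0 by exact: (svalP (q i)).
have hgood i : [/\ [/\ (0 < k i)%N, (N i <= M i)%N & P ^+ M i * th ^+ k i <= sg],
      N i.+1 = ((N i).+1 + k i + M i)%N,
      ball_sub (m i.+1) (v i.+1) (m i) (v i),
      abs (m i.+1 - v i.+1) <= P^-1 ^+ N i & forall s,
      abs (s - m i.+1) < abs (m i.+1 - v i.+1) ->
      [/\ U (k i) (iter (N i).+1 (Qstar p s Q) x0),
        forall j, (j <= M i)%N -> U 0 (iter ((N i).+1 + k i + j) (Qstar p s Q) x0) &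
        U 0 (iter (N i) (Qstar p s Q) x0)]].
  have := hnxt (q i); rewrite /N /m /v /k /M /good [q i.+1]/q iterS -/(q i).
  by case: (sval (q i)) => -[? ?] ?; case: (sval _) => -[? ?] ?; case: (nxt _).2.
have Nge i : (i <= N i)%N.
  elim: i => // i IH; have [_ -> _ _ _] := hgood i.
  by rewrite -addnA addSn ltnS (leq_trans IH)// leq_addr.
have subV i d : ball_sub (m (i + d)%N) (v (i + d)%N) (m i) (v i).
  elim: d => [|d IH] s; first by rewrite addn0.
  by rewrite addnS; have [_ _ sub _ _] := hgood (i + d)%N => /sub/IH.
have r0 i : 0 < abs (m i - v i) by case: (hst i) => + _ _ _; rewrite abs_gt0 subr_eq0.
have mV i j : (i <= j)%N -> abs (m j - m i) < abs (m i - v i).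
  move=> ij; apply: (subV i (j - i)%N); rewrite subnKC//.
  by rewrite subrr abs0.
have [lam hlam] : exists lam, kcvg abs m lam.
  apply: K_complete => d d0; have [n hn] := expr_small iP_lt1 d0.
  exists n.+1 => i j hi hj; have [_ _ _ hr _] := hgood n.
  have rd : abs (m n.+1 - v n.+1) < d.
    apply: le_lt_trans hr (le_lt_trans _ hn).
    have /andP[q0 q1] := iP_lt1.
    by rewrite -(subnKC (Nge n)) exprD ler_piMr ?exprn_ge0// exprn_ile1// ltW.
  apply: lt_trans rd; apply: abs_dist_lt (mV _ _ hi) _.
  by rewrite abs_subC; apply: mV.
have lamV i : abs (lam - m i) < abs (m i - v i).
  have [j hj] := hlam _ (r0 i).
  apply: (@abs_dist_lt _ _ (m (maxn i j))); last by apply: mV; rewrite leq_maxl.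
  by rewrite abs_subC; apply: hj; rewrite leq_maxr.
exists x0, lam, N, k, M; split; first by apply: sub0; exact: (lamV 0).
split=> [j jN|i].
  case: (hst 0) => _ _ _ /(_ _ (or_introl (lamV 0))) [_ /(_ j jN)].
  by rewrite orbitXC.
have [[k0 NM hPM] hN _ _ /(_ _ (lamV i.+1)) [hk hM h0]] := hgood i.
by split=> //; split=> //; rewrite hN.
Qed.

(** The deviation is at most sg at time N i, at most P sg <= th |y_k| after the jump, contracted by
    th^k on the way back, and again at most sg after M i steps since P^M th^k <= sg. *)
Lemma disc_follows lam x0 N k M : inD lam ->
  scheduled (fun n => iter n (Qstar p lam Q) x0) N k M -> exists2 s, 0 < s &
  forall x, abs (x - x0) <= s -> forall n, abs (iter n (Qstar p lam Q) x0) <= 1 /\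
    abs (iter n (Qstar p lam Q) x - iter n (Qstar p lam Q) x0) < 1.
Proof.
move=> hl [hinit hsch]; set f := Qstar p lam Q in hinit hsch *.
have P0 := P_gt0; have P1 := ltW P_gt1; have th0 := ltW th_gt0; have th1 := ltW th_lt1.
have al := abs_near1 hl; have sg1 := sg_lt1.
(* Before time N 0 only the Lipschitz bound P per step is available. *)
exists (sg / P ^+ N 0); first by rewrite divr_gt0// exprn_gt0.
move=> x hx; pose z n := iter n f x0; pose w n := iter n f x.
have lip n : abs (z n) <= 1 -> abs (w n - z n) < 1 ->
    abs (w n.+1 - z n.+1) <= P * abs (w n - z n).
  move=> hz hw; rewrite /z /w !iterS; apply: Qstar_lip => //; first by rewrite al.
  by rewrite -/(w n) -[w n](subrK (z n)); apply: absD_le => //; apply: ltW.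
suff main i : (forall n, (n <= N i)%N -> abs (z n) <= 1 /\ abs (w n - z n) < 1) /\
    abs (w (N i) - z (N i)) <= sg.
  move=> n; have Nge i : (i <= N i)%N.
    elim: i => // i IH; have [-> _ _ _ _] := hsch i.
    by rewrite -addnA addSn ltnS (leq_trans IH)// leq_addr.
  by have [h _] := main n; apply: h.
elim: i => [|i [IH IHN]].
  have [_ _ _ _ [zN _ _]] := hsch 0.
  have z1 n : (n <= N 0)%N -> abs (z n) <= 1.
    rewrite leq_eqVlt => /predU1P[->|]; [exact: U_le1 zN | exact: hinit].
  have hn n : (n <= N 0)%N -> abs (w n - z n) <= P ^+ n * (sg / P ^+ N 0).
    elim: n => [|n IHn] nN; first by rewrite mul1r.
    have {}IHn := IHn (ltnW nN).
    apply: le_trans (lip _ (z1 _ (ltnW nN)) _) _; last by rewrite exprS -mulrA ler_wpM2l// ltW.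
    apply: le_lt_trans IHn _; rewrite mulrCA.
    apply: le_lt_trans sg1; rewrite ler_piMr ?(ltW sg_gt0)// ler_pdivrMr ?exprn_gt0//.
    by rewrite mul1r ler_weXn2l// ltnW.
  have hsg n : (n <= N 0)%N -> abs (w n - z n) <= sg.
    move=> nN; apply: le_trans (hn n nN) _; rewrite mulrCA ler_piMr ?(ltW sg_gt0)//.
    by rewrite ler_pdivrMr ?exprn_gt0// mul1r ler_weXn2l.
  split; last exact: hsg.
  by move=> n nN; split; [exact: z1 | apply: le_lt_trans sg1; exact: hsg].
have [hN k0 NM hPM [zN zk zM]] := hsch i; set n := N i in zN zk zM hN NM IH IHN *.
have [zn1 dn1] := IH n (leqnn n).
have dS : abs (w n.+1 - z n.+1) <= th * abs (y (k i)).
  apply: le_trans (lip _ zn1 dn1) _.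
  apply: le_trans (_ : P * sg <= _); first by rewrite ler_wpM2l// ltW.
  by apply: le_trans P_sg _; rewrite ler_wpM2l// ltW// y_gt_rho.
have wk : U (k i) (w n.+1).
  apply: abs_dist_lt zk; apply: le_lt_trans dS _.
  by rewrite gtr_pMl ?th_lt1// y_gt0.
have hk a : (a <= k i)%N -> abs (z (n.+1 + a)%N) <= 1 /\
    abs (w (n.+1 + a)%N - z (n.+1 + a)%N) <= th ^+ a * th.
  move=> ak; rewrite /z /w addnC !iterD.
  have hU := iter_U hl zk ak; split; first exact: U_le1 hU.
  have := iter_contract hl hl wk zk (_ : _ <= th <= th) dS ak.
  rewrite subrr abs0 th0 lexx => /(_ isT) /le_trans; apply.
  rewrite (max_idPr _) ?mulr_ge0 ?exprn_ge0//.
  by rewrite ler_piMr ?y_le1 ?mulr_ge0 ?exprn_ge0.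
have hM j : (j <= M i)%N -> abs (w (n.+1 + k i + j)%N - z (n.+1 + k i + j)%N) <= sg.
  move=> jM; apply: le_trans (_ : P ^+ j * th ^+ k i <= _); last first.
    apply: le_trans hPM; rewrite ler_wpM2r ?exprn_ge0//.
    by rewrite ler_weXn2l.
  elim: j jM => [|j IHj] jM.
    rewrite addn0 mul1r; have [_ /le_trans] := hk _ (leqnn (k i)); apply.
    by rewrite ler_piMr ?exprn_ge0.
  have {}IHj := IHj (ltnW jM); rewrite addnS.
  apply: le_trans (lip _ _ _) _.
  - exact: U_le1 (zM _ (ltnW jM)).
  - apply: le_lt_trans IHj (le_lt_trans _ sg1); apply: le_trans hPM.
    by rewrite ler_wpM2r ?exprn_ge0// ler_weXn2l// ltnW.
  - by rewrite exprS -mulrA ler_wpM2l// ltW.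
rewrite hN; split; last exact: hM.
move=> a aN; have [an|na] := leqP a n; first exact: IH.
have [b hb] : exists b, a = (n.+1 + b)%N by exists (a - n.+1)%N; rewrite subnKC.
have [bk|kb] := leqP b (k i).
  rewrite hb; have [h1 h2] := hk b bk; split=> //; apply: le_lt_trans h2 _.
  by apply: le_lt_trans th_lt1; rewrite ler_piMl// exprn_ile1.
have [j hj] : exists j, b = (k i + j)%N by exists (b - k i)%N; rewrite subnKC// ltnW.
move: aN; rewrite hb hj addnA leq_add2l => jM; split; first exact: U_le1 (zM _ jM).
by apply: le_lt_trans sg1; exact: hM.
Qed.

(** * Itineraries *)

Lemma scheduled_runs z N k M : scheduled z N k M ->
  (forall L, exists2 n, (L <= n)%N & forall j, (j < L)%N -> abs (z (n + j)%N - 1) < 1) /\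
  (forall L, exists2 n, (L <= n)%N & ~~ (abs (z n - 1) < 1)).
Proof.
move=> [_ hz]; have Nge i : (i <= N i)%N.
  elim: i => // i IH; have [-> _ _ _ _] := hz i.
  by rewrite -addnA addSn ltnS (leq_trans IH)// leq_addr.
split=> L; have [_ k0 NM _ [_ zU zM]] := hz L; have LN := Nge L.
  exists ((N L).+1 + k L)%N => [|j jL].
    by rewrite addSn (leq_trans LN)// -addnS leq_addr.
  by rewrite -U0; apply: zM; rewrite (leq_trans (ltnW jL))// (leq_trans LN).
exists (N L).+1; first by rewrite (leq_trans LN).
by move: zU; rewrite -(prednK k0) => /US_notin.
Qed.

Section Itinerary.
Variables (lam x0 : K) (s rhat : R).
Hypothesis lamD : inD lam.
Hypothesis rhat_gt1 : 1 < rhat.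
Local Notation g := (Qstar p lam Q).
Hypothesis follows : forall x, abs (x - x0) <= s -> forall n,
  abs (iter n g x0) <= 1 /\ abs (iter n g x - iter n g x0) < 1.
Hypothesis runs : forall L, exists2 n, (L <= n)%N &
  forall j, (j < L)%N -> abs (iter (n + j) g x0 - 1) < 1.
Hypothesis exits : forall L, exists2 n, (L <= n)%N & ~~ (abs (iter n g x0 - 1) < 1).

Lemma follows_le1 x n : kclosed_ball abs x0 s x -> abs (iter n g x) <= 1.
Proof.
move=> hx; have [h1 h2] := follows hx n.
by rewrite -[iter n g x](subrK (iter n g x0)); apply: absD_le => //; apply: ltW.
Qed.

Lemma follows_near1 x n : kclosed_ball abs x0 s x ->
  (abs (iter n g x - 1) < 1) = (abs (iter n g x0 - 1) < 1).
Proof.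
move=> hx; have [_ h] := follows hx n; apply/idP/idP; last exact: abs_dist_lt.
by apply: abs_dist_lt; rewrite abs_subC.
Qed.

Lemma disc_in_julia z : kclosed_ball abs x0 s z -> filled_julia abs g rhat z.
Proof. by move=> hz n; apply: le_trans (follows_le1 n hz) (ltW rhat_gt1). Qed.

(* A common point of two iterates makes the itinerary eventually periodic;
   a run near 1 longer than the period then never ends. *)
Lemma disc_wandering : wandering g (kclosed_ball abs x0 s).
Proof.
suff key n d x y' : kclosed_ball abs x0 s x -> kclosed_ball abs x0 s y' ->
    iter n g x <> iter (n + d.+1) g y'.
  move=> n m [w [[x [hx hxw]] [y' [hy hyw]]]].
  have [nm|mn|//] := ltngtP n m.
    case: (key n (m - n).-1%N _ _ hx hy); rewrite prednK ?subn_gt0// subnKC ?hxw//.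
    exact: ltnW.
  case: (key m (n - m).-1%N _ _ hy hx); rewrite prednK ?subn_gt0// subnKC ?hyw//.
  exact: ltnW.
move=> hx hy e.
have per i : (n <= i)%N ->
    (abs (iter (i + d.+1) g x0 - 1) < 1) = (abs (iter i g x0 - 1) < 1).
  move=> ni; have [j ->] : exists j, i = (j + n)%N by exists (i - n)%N; rewrite subnK.
  transitivity (abs (iter (j + n + d.+1) g y' - 1) < 1); first by rewrite (follows_near1 _ hy).
  by rewrite -addnA iterD -e -iterD (follows_near1 _ hx).
(* From an exit time t after r, subtracting the period d.+1 repeatedly lands in the run starting at
   r. *)
have [r rn hr] := runs (n + d.+1); have [t rt] := exits r; case/negP.
have [j ->] : exists j, t = (r + j)%N by exists (t - r)%N; rewrite subnKC.
elim/ltn_ind: j => j IH.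
have [jd|dj] := ltnP j d.+1; first by apply: hr; rewrite (leq_trans jd)// leq_addl.
rewrite -(subnK dj) addnA per; last first.
  by rewrite (leq_trans _ (leq_addr _ _))// (leq_trans _ rn)// leq_addr.
by apply: IH; rewrite ltn_subrL (leq_trans _ dj).
Qed.

(* A cycle attracting the orbit is followed closely along a run near 1 longer
   than its period, so it lies near 1, contradicting the later exits. *)
Lemma disc_not_attracted : not_attracted abs g rhat (kclosed_ball abs x0 s).
Proof.
move=> [z [hz [z0 [k [[k0 _ per _] [c0 [s0 [_ [hzc hbasin]]]]]]]]].
have {hzc hbasin} [_ hb] := hbasin _ hzc.
(* The tolerance P^-k leaves room for k steps, each expanding by at most P. *)
have P0 := P_gt0; have Pk0 : 0 < P^-1 ^+ k by rewrite exprn_gt0 ?invr_gt0.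
have [N hN] := hb _ Pk0.
have [n nn hrun] := runs (N + k).
have [j [jk hj]] := hN n (leq_trans (leq_addr _ _) nn).
have w1 i := follows_le1 i hz.
have c1 i : abs (iter (n + i) g z - iter (j + i) g z0) < 1 -> abs (iter (j + i) g z0) <= 1.
  move=> h; rewrite -[iter (j + i) g z0](subKr (iter (n + i) g z)).
  by apply: absB_le => //; apply: ltW.
have /andP[q0 q1] := iP_lt1.
have track i : (i <= k)%N -> abs (iter (n + i) g z - iter (j + i) g z0) < P^-1 ^+ (k - i).
  elim: i => [|i IH] ik; first by rewrite !addn0 subn0.
  have {}IH := IH (ltnW ik).
  have lt1 : abs (iter (n + i) g z - iter (j + i) g z0) < 1.
    by apply: lt_le_trans IH _; rewrite exprn_ile1// ltW.
  rewrite !addnS !iterS; apply: le_lt_trans (Qstar_lip _ (w1 _) (c1 _ lt1)) _.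
    by rewrite (abs_near1 lamD).
  by rewrite -ltr_pdivlMl// -exprS -subSn.
have near i : (i < k)%N -> abs (iter (j + i) g z0 - 1) < 1.
  move=> ik; apply: (@abs_dist_lt _ _ (iter (n + i) g z)).
    rewrite abs_subC; apply: lt_le_trans (track _ (ltnW ik)) _.
    by rewrite exprn_ile1// ltW.
  by rewrite (follows_near1 _ hz); apply: hrun; rewrite (leq_trans ik)// leq_addl.
have cyc j' : (j' < k)%N -> abs (iter j' g z0 - 1) < 1.
  move=> j'k; have [jj'|j'j] := leqP j j'.
    rewrite -(subnKC jj'); apply: near; exact: leq_ltn_trans (leq_subr _ _) j'k.
  (* Points of the cycle before index j are reached by going once around. *)
  have -> : iter j' g z0 = iter (j + (j' + k - j)) g z0.
    by rewrite subnKC ?iterD ?per// (leq_trans (ltnW jk))// leq_addl.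
  by apply: near; rewrite ltn_subLR ?ltn_add2r// (leq_trans (ltnW jk))// leq_addl.
have [t Nt /negP] := exits N; apply.
have [j' [j'k hj']] := hN t Nt.
rewrite -(follows_near1 _ hz); apply: abs_dist_lt (cyc _ j'k).
by apply: lt_le_trans hj' _; rewrite exprn_ile1// ltW.
Qed.

End Itinerary.

Lemma wandering_disc_dense (rhat : R) (l : K) (e : R) : 1 < rhat -> inD l -> 0 < e -> exists lam,
  [/\ inD lam, abs (lam - l) < e & exists (c' : K) (s : R), [/\ 0 < s,
    forall z, kclosed_ball abs c' s z -> filled_julia abs (Qstar p lam Q) rhat z,
    wandering (Qstar p lam Q) (kclosed_ball abs c' s) &
    not_attracted abs (Qstar p lam Q) rhat (kclosed_ball abs c' s)]].
Proof.
move=> hr hl e0.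
have [|x0 [lam [N [k [M [lamV sch]]]]]] := @schedule_exists l (Num.min e 1) hl.
  by rewrite lt_min e0 ltr01 ge_min lexx orbT.
move: lamV; rewrite lt_min => /andP[lame lam1].
have lamD : inD lam by apply: abs_dist_lt hl.
have [runs exits] := scheduled_runs sch.
have [s s0 hs] := disc_follows lamD sch.
exists lam; split=> //; exists x0, s; split=> //.
- exact: disc_in_julia hr hs.
- exact: disc_wandering hs runs exits.
- exact: disc_not_attracted lamD hs runs exits.
Qed.

End Ultrametric.

(** * The tower y_k, the constants and the conclusion *)

Lemma exists_root_tower (K : closedFieldType) (p : nat) : (0 < p)%N ->
  exists y : nat -> K, y 0%N = 1 /\ forall k, y k.+1 ^+ p = p%:R * y k.
Proof.
move=> p0; have /choice[g hg] : forall u : K, exists v, v ^+ p = p%:R * u.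
  move=> u; have /closed_rootP[v] : size ('X^p - (p%:R * u)%:P) != 1%N.
    by rewrite size_XnsubC// eqSS -lt0n.
  by rewrite rootE !hornerE subr_eq0 => /eqP; exists v.
by exists (fun n => iter n g 1); split=> // k; rewrite iterS hg.
Qed.

Theorem theorem3p1
  (R : realType) (K : closedFieldType) (abs : K -> R) (p : nat)
  (hp : prime p) (hCp : is_Cp abs p)
  (rhat : R) (hrhat_val : exists w : K, w != 0 /\ abs w = rhat) (hrhat : 1 < rhat)
  (a : nat -> K) (Qf : K -> K)
  (hQ : forall z, inB abs rhat z ->
          kcvg abs (fun n => \sum_(i < n) a i * z ^+ i) (Qf z))
  (hnorm : exists c : R, c < powR (p%:R) (- ((p.-1)%:R)^-1) /\
                         forall i, abs (a i) * rhat ^+ i <= c) :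
  exists Lam' : K -> Prop,
    (forall lam, Lam' lam -> abs (lam - 1) < 1) /\
    (forall lam, abs (lam - 1) < 1 -> forall eps : R, 0 < eps ->
       exists lam', Lam' lam' /\ abs (lam' - lam) < eps) /\
    (forall lam, Lam' lam ->
       exists (c : K) (s : R), 0 < s /\
         (forall z, kclosed_ball abs c s z -> filled_julia abs (Qstar p lam Qf) rhat z) /\
         wandering (Qstar p lam Qf) (kclosed_ball abs c s) /\
         not_attracted abs (Qstar p lam Qf) rhat (kclosed_ball abs c s)).
Proof.
case: hCp => abs_ge0 [abs_eq0 [absM [absD_max [absp [K_complete _]]]]].
have [c [c_lt_rho a_le]] := hnorm.
set P : R := p%:R in absp c_lt_rho; set rho := powR _ _ in c_lt_rho.
have P1 : 1 < P by rewrite ltr1n prime_gt1.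
have P0 : 0 < P by apply: lt_trans P1.
have p0 := prime_gt0 hp.
have rhoE : P * rho ^+ p.-1 = 1.
  rewrite -powR_mulrn ?powR_ge0// -powRrM mulNr mulVf; last first.
    by rewrite pnatr_eq0 -lt0n -subn1 subn_gt0 prime_gt1.
  by rewrite powR_inv1 ?(ltW P0)// divff// gt_eqF.
have hQ1 z : abs z <= 1 -> kcvg abs (fun n => \sum_(i < n) a i * z ^+ i) (Qf z).
  by move=> hz; apply: hQ; apply: le_trans hz (ltW hrhat).
have c0 := series_bound_ge0 abs_ge0 a_le.
have Q_le := series_abs_le abs_ge0 abs_eq0 absM absD_max hrhat a_le hQ1.
have Q_lip := series_lip abs_ge0 abs_eq0 absM absD_max hrhat a_le hQ1.
have c1 := c_lt1 hp c_lt_rho rhoE.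
have Q_approx (e : R) : 0 < e -> exists q : {poly K}, forall z, abs z <= 1 ->
    abs (Qf z - q.[z]) < e.
  move=> e0; have ir : 0 <= rhat^-1 < 1.
    by rewrite invr_ge0 invf_lt1 ?hrhat ?ltW// (lt_trans ltr01).
  have [t ht] := expr_small ir e0; exists (\poly_(i < t) a i) => z hz.
  apply: le_lt_trans ht; apply: le_trans
    (series_tail_le abs_ge0 abs_eq0 absM absD_max hrhat a_le hQ1 t hz) _.
  by rewrite ler_piMl ?(ltW c1)// exprn_ge0//; case/andP: ir.
have [y [y0 yS]] := exists_root_tower K p0.
have y1_lt1 : abs (y 1%N) < 1.
  rewrite ltNge; apply/negP => h.
  have : abs (y 1%N) ^+ p < 1.
    rewrite -(absX abs_eq0 absM) yS y0 mulr1 absp invf_lt1//.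
  by rewrite ltNge exprn_ege1.
(* The three sources of contraction in [Qstar_U_contract]. *)
pose th := Num.max P^-1 (Num.max (abs (y 1%N)) c).
have th_lt1 : th < 1 by rewrite !gt_max invf_lt1// P1 y1_lt1.
have iP_le : P^-1 <= th by rewrite le_max lexx.
have y1_le : abs (y 1%N) <= th by rewrite !le_max lexx orbT.
have c_le : c <= th by rewrite !le_max lexx !orbT.
(* With sg = th rho / P, a deviation sg multiplied by P on leaving E is at most th |y_k| for every
   k, as rho < |y_k|. *)
have sg_gt0 : 0 < th * rho / P.
  rewrite !mulr_gt0 ?invr_gt0//; first by apply: lt_le_trans iP_le; rewrite invr_gt0.
  exact: le_lt_trans c_lt_rho.
have P_sg : P * (th * rho / P) <= th * rho by rewrite mulrC divfK// gt_eqF.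
(* Taking all parameters with the desired disc leaves only density to prove. *)
pose good lam := abs (lam - 1) < 1 /\ exists (c' : K) (s : R), 0 < s /\
  (forall z, kclosed_ball abs c' s z -> filled_julia abs (Qstar p lam Qf) rhat z) /\
  wandering (Qstar p lam Qf) (kclosed_ball abs c' s) /\
  not_attracted abs (Qstar p lam Qf) rhat (kclosed_ball abs c' s).
exists good; split; [by move=> lam []|split; last by move=> lam []].
move=> lam hlam e e0.
have [lam' [h1 h2 [c' [s [s0 hj hw hn]]]]] :=
  wandering_disc_dense abs_ge0 abs_eq0 absM absD_max hp absp c0 c_lt_rho rhoE
    Q_le Q_lip y0 yS th_lt1 iP_le y1_le c_le Q_approx sg_gt0 P_sg K_complete
    hrhat hlam e0.
by exists lam'; split=> //; split=> //; exists c', s.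
Qed.
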